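(* The diagram $\vec{L}^{\mathrm{u}}$ has a lifting, with respect to the functor $\mathrm{V}^1$, by unital C*-subalgebras of $\mathrm{M}_2(\mathrm{C}([0,1],\mathbb{C}))$. Explicitly, there are unital C*-subalgebras $A,B,C,D$ of $\mathrm{M}_2(\mathrm{C}([0,1],\mathbb{C}))$ (up to isomorphism) and unital C*-homomorphisms $e\colon A\to B$, $s\colon B\to B$, $f,g\colon B\to C$, $h\colon C\to D$, $v\colon D\to D$ such that $$f\circ e=g\circ e,\quad s\circ e=e,\quad h\circ f\circ s=v\circ h\circ f,\quad v\circ h\circ g=h\circ g,$$ $s$ and $v$ are both involutive automorphisms, and there are isomorphisms of monoids with order-unit $$\eta_A\colon(\mathrm{V}(A),[1_A])\to(\mathbb{Z}^+,1),\quad \eta_B\colon(\mathrm{V}(B),[1_B])\to(\mathbb{Z}^+\times\mathbb{Z}^+,(1,1)),$$ $$\eta_C\colon(\mathrm{V}(C),[1_C])\to(\mathbb{Z}^+\times\mathbb{Z}^+,(1,1)),\quad \eta_D\colon(\mathrm{V}(D),[1_D])\to(\mathbb{Z}^+,2)$$ with $\eta_B\mathrm{V}(e)=\boldsymbol{e}\,\eta_A$, $\eta_B\mathrm{V}(s)=\boldsymbol{s}\,\eta_B$, $\eta_C\mathrm{V}(f)=\eta_C\mathrm{V}(g)=\eta_B$, $\eta_D\mathrm{V}(h)=\boldsymbol{h}\,\eta_C$, and $\eta_D\mathrm{V}(v)=\eta_D$.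
   Context: $\mathbb{Z}^+=\{0,1,2,\dots\}$; $\boldsymbol{e}(x)=(x,x)$, $\boldsymbol{s}(x,y)=(y,x)$, $\boldsymbol{h}(x,y)=x+y$ for $x,y\in\mathbb{Z}^+$. The diagram $\vec{L}^{\mathrm{u}}$ consists of the vertices $(\mathbb{Z}^+,1)$, $(\mathbb{Z}^+\times\mathbb{Z}^+,(1,1))$ (twice), $(\mathbb{Z}^+,2)$, with arrow $\boldsymbol{e}$ from the first to the second vertex, the loop $\boldsymbol{s}$ on the second vertex, two arrows from the second to the third vertex, both equal to the identity, the arrow $\boldsymbol{h}$ from the third to the fourth vertex, and the identity as a loop on the fourth vertex. $\mathrm{C}([0,1],\mathbb{C})$ is the C*-algebra of continuous complex-valued functions on the unit interval. An automorphism is involutive if its square is the identity. For a ring $R$, $\mathrm{V}(R)$ is the commutative monoid of equivalence classes $[a]_R$ of idempotents $a$ of $\mathrm{M}_\infty(R)=\bigcup_n\mathrm{M}_n(R)$ (embedding $\mathrm{M}_n(R)$ into $\mathrm{M}_{n+1}(R)$ by adding a zero row and column), where $a\sim b$ if $a=xy$, $b=yx$ for some $x,y\in\mathrm{M}_\infty(R)$, with addition determined by $[a]_R+[b]_R=[a+b]_R$ whenever $ab=ba=0$. A ring homomorphism $f\colon R\to S$ induces $\mathrm{V}(f)\colon[a]_R\mapsto[f(a)]_S$. For unital $R$, $\mathrm{V}^1(R)=(\mathrm{V}(R),[1_R])$. Isomorphisms of monoids with order-unit are monoid isomorphisms sending the order-unit to the order-unit. *)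

(* Defs.v *)
From HB Require Import structures.
From mathcomp Require Import all_boot all_order all_algebra.
From mathcomp Require Import generic_quotient complex.
From mathcomp Require Import all_classical all_reals.
From mathcomp Require Import topology normedtype.

Set Implicit Arguments.
Unset Strict Implicit.
Unset Printing Implicit Defensive.

Import Order.TTheory GRing.Theory Num.Theory.
Import numFieldNormedType.Exports.

Local Open Scope classical_set_scope.
Local Open Scope ring_scope.
Local Open Scope quotient_scope.

(* M_oo(R) is the union of the M_n(R), so its elements are represented by pairs
   of a size n and an n x n matrix.  For n <= k, mxpad k a is the image of a in
   M_k(R): pid_mx n being the k x n (resp. n x k) partial identity, a is
   extended by zero rows and columns. *)
Definition mxpad (R : pzRingType) (n k : nat) (a : 'M[R]_n) : 'M[R]_k :=
  (pid_mx n : 'M_(k, n)) *m a *m (pid_mx n : 'M_(n, k)).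

Definition mx_idem (R : pzRingType) : pred {n : nat & 'M[R]_n} :=
  fun a => tagged a *m tagged a == tagged a.

Definition idem (R : pzRingType) : Type :=
  {a : {n : nat & 'M[R]_n} | @mx_idem R a}.
HB.instance Definition _ (R : pzRingType) := Choice.on (idem R).

Definition idim (R : pzRingType) (a : idem R) : nat := tag (val a).
Definition imx (R : pzRingType) (a : idem R) : 'M[R]_(idim a) := tagged (val a).

Lemma imxK (R : pzRingType) (a : idem R) : imx a *m imx a = imx a.
Proof. exact/eqP/(valP a). Qed.

Definition mkidem (R : pzRingType) (n : nat) (a : 'M[R]_n)
    (aK : a *m a = a) : idem R :=
  exist _ (Tagged (fun n => 'M[R]_n) a) (introT eqP aK).

(* a = x y and b = y x in M_oo(R): the four matrices live in a common M_k(R). *)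
Definition mvn_equiv (R : pzRingType) (n m : nat) (a : 'M[R]_n) (b : 'M[R]_m) :=
  exists k : nat, [/\ (n <= k)%N, (m <= k)%N &
    exists x y : 'M[R]_k, mxpad k a = x *m y /\ mxpad k b = y *m x].

Section MvnTheory.
Variable R : pzRingType.

Lemma pid_mxK n k : (n <= k)%N ->
  (pid_mx n : 'M[R]_(n, k)) *m (pid_mx n : 'M[R]_(k, n)) = 1%:M.
Proof. by move=> le_nk; rewrite pid_mx_id // pid_mx_1. Qed.

Lemma mvn_rect n m (a : 'M[R]_n) (b : 'M[R]_m) (x : 'M_(n, m)) (y : 'M_(m, n)) :
  a = x *m y -> b = y *m x -> mvn_equiv a b.
Proof.
move=> -> ->; exists (n + m)%N; split; rewrite ?leq_addl ?leq_addr //.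
set k := (n + m)%N; set p := (pid_mx n : 'M[R]_(k, n)).
set q := (pid_mx n : 'M[R]_(n, k)); set r := (pid_mx m : 'M[R]_(k, m)).
set s := (pid_mx m : 'M[R]_(m, k)).
have qp : q *m p = 1%:M by apply: pid_mxK; rewrite leq_addr.
have sr : s *m r = 1%:M by apply: pid_mxK; rewrite leq_addl.
exists (p *m x *m s), (r *m y *m q); rewrite /mxpad -/p -/q -/r -/s -!mulmxA.
by rewrite (mulmxA s r) (mulmxA q p) sr qp !mul1mx.
Qed.

Lemma mvn_equivP n m (a : 'M[R]_n) (b : 'M[R]_m) :
    a *m a = a -> b *m b = b -> mvn_equiv a b ->
  exists x : 'M_(n, m), exists y : 'M_(m, n), a = x *m y /\ b = y *m x.
Proof.
move=> aK bK [k [le_nk le_mk [x [y [Exy Eyx]]]]].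
set p := (pid_mx n : 'M[R]_(k, n)); set q := (pid_mx n : 'M[R]_(n, k)).
set r := (pid_mx m : 'M[R]_(k, m)); set s := (pid_mx m : 'M[R]_(m, k)).
have qp : q *m p = 1%:M by exact: pid_mxK.
have sr : s *m r = 1%:M by exact: pid_mxK.
have {}Exy : x *m y = p *m a *m q by [].
have {}Eyx : y *m x = r *m b *m s by [].
have padx l (c : 'M_(k, l)) : x *m (y *m c) = p *m (a *m (q *m c)).
  by rewrite mulmxA Exy -!mulmxA.
have pady l (c : 'M_(k, l)) : y *m (x *m c) = r *m (b *m (s *m c)).
  by rewrite mulmxA Eyx -!mulmxA.
have qpc l (c : 'M_(n, l)) : q *m (p *m c) = c by rewrite mulmxA qp mul1mx.
have src l (c : 'M_(m, l)) : s *m (r *m c) = c by rewrite mulmxA sr mul1mx.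
have aKc l (c : 'M_(n, l)) : a *m (a *m c) = a *m c by rewrite mulmxA aK.
have bKc l (c : 'M_(m, l)) : b *m (b *m c) = b *m c by rewrite mulmxA bK.
exists (a *m q *m x *m r *m b), (b *m s *m y *m p *m a).
rewrite -!mulmxA; split.
  by rewrite bKc -pady !padx !qpc !aKc aK.
by rewrite aKc -padx !pady !src !bKc bK.
Qed.

Lemma mvn_refl n (a : 'M[R]_n) : a *m a = a -> mvn_equiv a a.
Proof. by move=> aK; apply: (@mvn_rect _ _ _ _ a a). Qed.

Lemma mvn_sym n m (a : 'M[R]_n) (b : 'M[R]_m) :
  mvn_equiv a b -> mvn_equiv b a.
Proof.
by move=> [k [nk mk [x [y [? ?]]]]]; exists k; split=> //; exists y, x.
Qed.

Lemma mvn_trans n m l (a : 'M[R]_n) (b : 'M[R]_m) (c : 'M[R]_l) :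
  a *m a = a -> b *m b = b -> c *m c = c ->
  mvn_equiv a b -> mvn_equiv b c -> mvn_equiv a c.
Proof.
move=> aK bK cK /(mvn_equivP aK bK)[x [y [Ea Eb]]].
move=> /(mvn_equivP bK cK)[z [w [Eb' Ec]]].
apply: (@mvn_rect _ _ _ _ (x *m z) (w *m y)).
  by rewrite mulmxA -[x *m z *m w]mulmxA -Eb' Eb -aK Ea !mulmxA.
by rewrite mulmxA -[w *m y *m x]mulmxA -Eb Eb' -cK Ec !mulmxA.
Qed.

Definition idem_equiv (a b : idem R) : bool := `[< mvn_equiv (imx a) (imx b) >].

Lemma idem_equiv_is_equiv : equiv_class_of idem_equiv.
Proof.
split=> [a|a b|b a c].
- by apply/asboolP/mvn_refl/imxK.
- by apply/asboolP/asboolP; apply: mvn_sym.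
- move=> /asboolP ab /asboolP bc; apply/asboolP.
  by apply: mvn_trans ab bc; apply: imxK.
Qed.

Canonical idem_equiv_equiv := EquivRelPack idem_equiv_is_equiv.

End MvnTheory.

Definition V (R : pzRingType) : Type := {eq_quot @idem_equiv R}.
HB.instance Definition _ (R : pzRingType) := Choice.on (V R).
HB.instance Definition _ (R : pzRingType) := EqQuotient.on (V R).

Section VMonoid.
Variable R : pzRingType.

Definition Vcls (a : idem R) : V R := \pi_(V R) a.

Lemma VclsP (a b : idem R) :
  Vcls a = Vcls b <-> mvn_equiv (imx a) (imx b).
Proof.
split; first by move/eqquotP/asboolP.
by move=> ab; apply/eqquotP/asboolP.
Qed.

Lemma Vcls_surj (u : V R) : exists a, u = Vcls a.
Proof. by exists (repr u); rewrite /Vcls reprK. Qed.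

Lemma block_idem n m (a : 'M[R]_n) (b : 'M[R]_m) :
  a *m a = a -> b *m b = b ->
  block_mx a 0 0 b *m block_mx a 0 0 b = block_mx a 0 0 b.
Proof.
by move=> aK bK; rewrite mulmx_block !mulmx0 !mul0mx !addr0 !add0r aK bK.
Qed.

Definition idem_add (a b : idem R) : idem R :=
  mkidem (block_idem (imxK a) (imxK b)).

Definition idem0 : idem R := mkidem (mul0mx _ (0 : 'M[R]_0)).

Definition Vzero : V R := Vcls idem0.
Definition Vadd (u v : V R) : V R := Vcls (idem_add (repr u) (repr v)).

Lemma mvn_block n m n' m' (a : 'M[R]_n) (b : 'M[R]_m)
    (a' : 'M[R]_n') (b' : 'M[R]_m') :
    a *m a = a -> b *m b = b -> a' *m a' = a' -> b' *m b' = b' ->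
    mvn_equiv a a' -> mvn_equiv b b' ->
  mvn_equiv (block_mx a 0 0 b) (block_mx a' 0 0 b').
Proof.
move=> aK bK aK' bK' /mvn_equivP[] // x [y [-> ->]] /mvn_equivP[] // z [w [-> ->]].
apply: (@mvn_rect _ _ _ _ _ (block_mx x 0 0 z) (block_mx y 0 0 w)).
  by rewrite mulmx_block !mulmx0 !mul0mx !addr0 !add0r.
by rewrite mulmx_block !mulmx0 !mul0mx !addr0 !add0r.
Qed.

Lemma Vcls_repr (a : idem R) : mvn_equiv (imx (repr (Vcls a))) (imx a).
Proof. by apply/VclsP; rewrite /Vcls reprK. Qed.

Lemma Vadd_block (a b : idem R) : Vadd (Vcls a) (Vcls b) = Vcls (idem_add a b).
Proof.
by apply/VclsP; apply: mvn_block; rewrite ?imxK //; exact: Vcls_repr.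
Qed.

Lemma mvn_cast n m (e : n = m) (a : 'M[R]_n) : a *m a = a ->
  mvn_equiv a (castmx (e, e) a).
Proof. by case: m / e => aK; rewrite castmx_id; exact: mvn_refl. Qed.

Lemma mvn_blockA n m l (a : 'M[R]_n) (b : 'M[R]_m) (c : 'M[R]_l) :
    a *m a = a -> b *m b = b -> c *m c = c ->
  mvn_equiv (block_mx a 0 0 (block_mx b 0 0 c))
            (block_mx (block_mx a 0 0 b) 0 0 c).
Proof.
move=> aK bK cK; have := @block_mxA R _ _ _ _ _ _ a 0 0 0 b 0 0 0 c.
rewrite /= !row_mx0 !col_mx0 => ->; apply/mvn_sym/mvn_cast.
by do !apply: block_idem.
Qed.

Lemma VaddA : associative Vadd.
Proof.
move=> u v w; have [a ->] := Vcls_surj u; have [b ->] := Vcls_surj v.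
have [c ->] := Vcls_surj w; rewrite !Vadd_block; apply/VclsP.
by apply: mvn_blockA; exact: imxK.
Qed.

Lemma VaddC : commutative Vadd.
Proof.
move=> u v; have [a ->] := Vcls_surj u; have [b ->] := Vcls_surj v.
rewrite !Vadd_block; apply/VclsP.
apply: (@mvn_rect _ _ _ _ _ (block_mx 0 (imx a) (imx b) 0)
                            (block_mx 0 (imx b) (imx a) 0));
  by rewrite mulmx_block !mulmx0 !mul0mx !addr0 !add0r !imxK.
Qed.

Lemma Vadd0 : left_id Vzero Vadd.
Proof.
move=> u; have [a ->] := Vcls_surj u; rewrite Vadd_block; apply/VclsP.
apply: (@mvn_rect _ _ _ _ _ (col_mx 0 (imx a)) (row_mx 0 (imx a))).
  by rewrite mul_col_row !mul0mx !mulmx0 imxK.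
by rewrite mul_row_col mul0mx add0r imxK.
Qed.

End VMonoid.

HB.instance Definition _ (R : pzRingType) :=
  GRing.isNmodule.Build (V R) (@VaddA R) (@VaddC R) (@Vadd0 R).

Lemma orth_idem (R : pzRingType) n (a b : 'M[R]_n) :
  a *m a = a -> b *m b = b -> a *m b = 0 -> b *m a = 0 ->
  (a + b) *m (a + b) = a + b.
Proof.
by move=> aK bK ab ba; rewrite mulmxDl !mulmxDr aK bK ab ba addr0 add0r.
Qed.

(* Extending an idempotent by zeros does not change its class. *)
Lemma mvn_pad (R : pzRingType) n k (a : 'M[R]_n) :
  (n <= k)%N -> a *m a = a -> mvn_equiv (mxpad k a) a.
Proof.
move=> le_nk aK.
apply: (@mvn_rect _ _ _ _ _ ((pid_mx n : 'M_(k, n)) *m a)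
                            (a *m (pid_mx n : 'M_(n, k)))).
  by rewrite /mxpad -!mulmxA (mulmxA a a) aK.
by rewrite -!mulmxA (mulmxA (pid_mx n)) pid_mxK // mul1mx aK.
Qed.

(* The rule that determines the addition of V(R). *)
Lemma Vadd_orth (R : pzRingType) n (a b : 'M[R]_n) (aK : a *m a = a)
    (bK : b *m b = b) (ab : a *m b = 0) (ba : b *m a = 0) :
  Vcls (mkidem aK) + Vcls (mkidem bK) = Vcls (mkidem (orth_idem aK bK ab ba)).
Proof.
rewrite [LHS]Vadd_block; apply/VclsP.
apply: (@mvn_rect _ _ _ _ _ (col_mx a b) (row_mx a b)).
  by rewrite mul_col_row aK bK ab ba.
by rewrite mul_row_col aK bK.
Qed.

(* The order-unit [1_R], with 1_R viewed in M_1(R). *)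
Definition V1 (R : pzRingType) : V R := Vcls (mkidem (mul1mx (1%:M : 'M[R]_1))).

Section VFunctor.
Variables (R S : pzRingType) (f : {rmorphism R -> S}).

Lemma map_idem n (a : 'M[R]_n) :
  a *m a = a -> map_mx f a *m map_mx f a = map_mx f a.
Proof. by move=> aK; rewrite -map_mxM aK. Qed.

Definition idem_map (a : idem R) : idem S := mkidem (map_idem (imxK a)).

Definition Vmap (u : V R) : V S := Vcls (idem_map (repr u)).

Lemma VmapE (a : idem R) : Vmap (Vcls a) = Vcls (idem_map a).
Proof.
apply/VclsP.
have [//||x [y [Ea Eb]]] := mvn_equivP _ _ (Vcls_repr a); rewrite ?imxK //.
apply: (@mvn_rect _ _ _ _ _ (map_mx f x) (map_mx f y)); rewrite -map_mxM.
  by rewrite -Ea.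
by rewrite -Eb.
Qed.

End VFunctor.

(* f is an isomorphism (M, u) -> (N, v) of monoids with order-unit. *)
Definition ou_iso (M N : nmodType) (u : M) (v : N) (f : {additive M -> N}) :=
  bijective f /\ f u = v.

Section PointwiseContinuity.
Variables (X : topologicalType) (K : numClosedFieldType).
Implicit Types f g : X -> K.

Lemma cts_cst (z : K) : continuous (fun _ : X => z).
Proof. by move=> t; apply: cvg_cst. Qed.

Lemma cts_add f g :
  continuous f -> continuous g -> continuous (fun t => f t + g t).
Proof. by move=> cf cg t; apply: cvgD; [exact: cf|exact: cg]. Qed.

Lemma cts_opp f : continuous f -> continuous (fun t => - f t).
Proof. by move=> cf t; apply: cvgN; exact: cf. Qed.

Lemma cts_mul f g :
  continuous f -> continuous g -> continuous (fun t => f t * g t).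
Proof. by move=> cf cg t; apply: cvgM; [exact: cf|exact: cg]. Qed.

Lemma cts_conj f : continuous f -> continuous (fun t => (f t)^*).
Proof.
move=> cf t; apply/cvgrPdist_lt => e e0.
have /cvgrPdist_lt/(_ e e0) := cf t.
by apply: filterS => z; rewrite -rmorphB norm_conjC.
Qed.

End PointwiseContinuity.

Definition CC (R : realType) : numClosedFieldType := R[i].

Definition unitI (R : realType) : topologicalType := `[0 : R, 1 : R]%classic.

Definition C01 (R : realType) : Type := continuousType (unitI R) (CC R).
HB.instance Definition _ (R : realType) := Choice.on (C01 R).

(* The topology of uniform convergence, that is, of the supremum norm. *)
HB.instance Definition _ (R : realType) := Uniform.copy (C01 R)
  (initial_topology (fun f : C01 R => f : {uniform unitI R -> CC R})).

Section C01Ring.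
Variable R : realType.
Implicit Types f g h : C01 R.

Definition fun_of_C01 f : unitI R -> CC R := f.
Coercion fun_of_C01 : C01 >-> Funclass.

Definition c01 (u : unitI R -> CC R) (cu : continuous u) : C01 R :=
  (mkcts cu : continuousType (unitI R) (CC R)).

Lemma c01P f g : f = g <-> (forall t, f t = g t).
Proof. exact: continuousEP. Qed.

Lemma c01_cts f : continuous (f : unitI R -> CC R).
Proof. exact: cts_fun. Qed.

Definition C01_cst z : C01 R := c01 (@cts_cst (unitI R) (CC R) z).

Definition C01_add f g := c01 (cts_add (@c01_cts f) (@c01_cts g)).
Definition C01_opp f := c01 (cts_opp (@c01_cts f)).
Definition C01_mul f g := c01 (cts_mul (@c01_cts f) (@c01_cts g)).
Definition C01_conj f := c01 (cts_conj (@c01_cts f)).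

Let addA : associative C01_add.
Proof. by move=> f g h; apply/c01P => t; exact: addrA. Qed.
Let addC : commutative C01_add.
Proof. by move=> f g; apply/c01P => t; exact: addrC. Qed.
Let add0 : left_id (C01_cst 0) C01_add.
Proof. by move=> f; apply/c01P => t; exact: add0r. Qed.
Let addN : left_inverse (C01_cst 0) C01_opp C01_add.
Proof. by move=> f; apply/c01P => t; exact: addNr. Qed.

HB.instance Definition _ := GRing.isZmodule.Build (C01 R) addA addC add0 addN.

Let mulA : associative C01_mul.
Proof. by move=> f g h; apply/c01P => t; exact: mulrA. Qed.
Let mulC : commutative C01_mul.
Proof. by move=> f g; apply/c01P => t; exact: mulrC. Qed.
Let mul1 : left_id (C01_cst 1) C01_mul.
Proof. by move=> f; apply/c01P => t; exact: mul1r. Qed.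
Let mulD : left_distributive C01_mul C01_add.
Proof. by move=> f g h; apply/c01P => t; exact: mulrDl. Qed.
Let one_neq0 : C01_cst 1 != 0.
Proof.
have I0 : (0 : R) \in `[0 : R, 1 : R]%classic by rewrite inE/= in_itv/= lexx ler01.
apply/eqP => /c01P/(_ (exist _ 0 I0))/eqP.
by rewrite /= oner_eq0.
Qed.

HB.instance Definition _ :=
  GRing.Zmodule_isComNzRing.Build (C01 R) mulA mulC mul1 mulD one_neq0.

End C01Ring.

Definition mxstar (R : realType) (a : 'M[C01 R]_2) : 'M[C01 R]_2 :=
  map_mx (@C01_conj R) a^T.

Lemma nbhs_C01 (R : realType) (f : C01 R) (P : set (C01 R)) :
  nbhs f P <-> exists E, entourage E /\
    (forall g : C01 R, (forall t, E (f t, g t)) -> P g).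
Proof.
rewrite -nbhs_entourageE; split.
- move=> [Q [Q']]; rewrite uniform_entourage => -[E entE sE] sQ sP.
  exists E; split=> // g Efg; apply: sP; apply/mem_set/sQ/sE => t _; exact: Efg.
- move=> [E [entE sP]]; exists [set fg : C01 R * C01 R | forall t, E (fg.1 t, fg.2 t)].
    exists [set fg : {uniform unitI R -> CC R} * {uniform unitI R -> CC R} | forall t, E (fg.1 t, fg.2 t)] => //.
    rewrite uniform_entourage; exists E => // fg /= H t; exact: H.
  by move=> g /set_mem; exact: sP.
Qed.

Lemma closed_M2C01P (R : realType) (S : set 'M[C01 R]_2) :
  closed S <-> forall a : 'M[C01 R]_2,
    (forall eps : CC R, 0 < eps ->
      exists2 b, S b & forall i j t, `|a i j t - b i j t| < eps) -> S a.
Proof.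
split=> [clS a aS|clS a clSa].
- apply: clS => B [P aP sP].
  have {}aP i j := (@nbhs_C01 _ _ _).1 (aP i j).
  pose E i j := projT1 (cid (aP i j)).
  have HE i j := projT2 (cid (aP i j)).
  have : entourage [set xy | forall i j, E i j xy].
    apply: (@filter_forall _ _ (fun i xy => forall j, E i j xy) entourage _) => i.
    apply: (@filter_forall _ _ (fun j xy => E i j xy) entourage _) => j.
    by case: (HE i j).
  rewrite -entourage_ballE => -[e /= e0 sE].
  have [b Sb ab] := aS e e0; exists b; split=> //; apply: sP => i j.
  by apply: (HE i j).2 => t; apply: sE; exact: ab.
- apply: clS => e e0.
  have : nbhs a [set b : 'M[C01 R]_2 | forall i j t, `|a i j t - b i j t| < e].
    exists (fun i j => [set g : C01 R | forall t, `|a i j t - g t| < e]) => //.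
    move=> i j; apply/nbhs_C01; exists [set xy | ball xy.1 e xy.2]; split=> //.
    by rewrite -entourage_ballE; exists e.
  by move=> /clSa[b [Sb ab]]; exists b.
Qed.

(* The C*-norm topology of M_2(C([0,1], C)) is that of entrywise uniform
   convergence, which is the matrix topology over C01 R: see closed_M2C01P.
   The scalar z acts as the constant function z. *)
Record csubalg (R : realType) := CSubalg {
  csa_set :> set 'M[C01 R]_2;
  csa1 : csa_set 1;
  csaB : forall a b, csa_set a -> csa_set b -> csa_set (a - b);
  csaM : forall a b, csa_set a -> csa_set b -> csa_set (a * b);
  csaZ : forall (z : CC R) a, csa_set a -> csa_set (C01_cst z *: a);
  csaS : forall a, csa_set a -> csa_set (mxstar a);
  csa_closed : closed csa_set
}.

Definition csa_type (R : realType) (A : csubalg R) : Type :=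
  {a : 'M[C01 R]_2 | a \in csa_set A}.
Coercion csa_type : csubalg >-> Sortclass.

Section CSubalgTheory.
Variables (R : realType) (A : csubalg R).

HB.instance Definition _ := SubChoice.on (csa_type A).

Let mem_subring : subring_closed (fun a : 'M[C01 R]_2 => a \in csa_set A).
Proof.
split=> [|a b|a b]; rewrite !inE; [exact: csa1|exact: csaB|exact: csaM].
Qed.

HB.instance Definition _ :=
  GRing.SubChoice_isSubNzRing.Build _ _ (csa_type A) mem_subring.

Lemma csaZ_subproof (z : CC R) (a : csa_type A) :
  C01_cst z *: val a \in csa_set A.
Proof. by rewrite inE; apply: csaZ; apply/set_mem/(valP a). Qed.

Definition csa_scale (z : CC R) (a : csa_type A) : csa_type A :=
  exist _ (C01_cst z *: val a) (csaZ_subproof z a).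

Lemma csaS_subproof (a : csa_type A) : mxstar (val a) \in csa_set A.
Proof. by rewrite inE; apply: csaS; apply/set_mem/(valP a). Qed.

Definition csa_star (a : csa_type A) : csa_type A :=
  exist _ (mxstar (val a)) (csaS_subproof a).

Let scaleA z w a : csa_scale z (csa_scale w a) = csa_scale (z * w) a.
Proof.
apply: val_inj; rewrite /= scalerA; congr (_ *: _).
by apply/c01P.
Qed.
Let scale1 : left_id 1 csa_scale.
Proof. by move=> a; apply: val_inj; rewrite /= scale1r. Qed.
Let scaleDr : right_distributive csa_scale +%R.
Proof. by move=> z a b; apply: val_inj; rewrite /= scalerDr. Qed.
Let scaleDl a : {morph csa_scale^~ a : z w / z + w}.
Proof.
move=> z w; apply: val_inj; rewrite /= -scalerDl; congr (_ *: _).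
by apply/c01P.
Qed.

HB.instance Definition _ := GRing.Zmodule_isLmodule.Build (CC R) (csa_type A)
  scaleA scale1 scaleDr scaleDl.

Let scaleAl (z : CC R) (a b : csa_type A) : z *: (a * b) = (z *: a) * b.
Proof. by apply: val_inj; rewrite /= -scalerAl. Qed.

HB.instance Definition _ :=
  GRing.Lmodule_isLalgebra.Build (CC R) (csa_type A) scaleAl.

End CSubalgTheory.

(* An lrmorphism is C-linear and multiplicative, and maps 1 to 1. *)
Record star_hom (R : realType) (A B : csubalg R) := StarHom {
  star_hom_fun :> {lrmorphism csa_type A -> csa_type B};
  star_homS : forall a : A, star_hom_fun (csa_star a) = csa_star (star_hom_fun a)
}.

Definition arrow_e (x : nat) : nat * nat := (x, x).
Definition arrow_s (x : nat * nat) : nat * nat := (x.2, x.1).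
Definition arrow_h (x : nat * nat) : nat := (x.1 + x.2)%N.

(* Main.v *)
(* Let D be the algebra of constant matrices, C = {a | a(0) is diagonal}, B the
   constant diagonal matrices and A the constant scalar matrices.  The maps e
   and f are the inclusions, s and v are conjugation by the flip, h is evaluation
   at 1, and g is conjugation by w / sqrt(w w^* ), w(t) = [[1, -t], [t, 1]].
   Since w(0) = 1, f and g agree at 0; and g at 1 maps B to flip-invariant
   matrices, so v h g = h g.  The crucial point is that V(C) = V(B): an
   idempotent matrix a over C is joined to the constant a(0) by the idempotents
   t |-> a(r t), 0 <= r <= 1, which stay in C, and close idempotents are
   equivalent.  The monoids V of A, B, D are computed by ranks, and the rank of
   an idempotent matrix over a field of characteristic 0 is its trace. *)
From HB Require Import structures.
Require Import Defs.
From mathcomp Require Import all_boot all_order all_algebra.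
From mathcomp Require Import complex.
From mathcomp Require Import all_classical all_reals.
From mathcomp Require Import topology normedtype.

Set Implicit Arguments.
Unset Strict Implicit.
Unset Printing Implicit Defensive.

Import Order.TTheory GRing.Theory Num.Theory.
Import numFieldNormedType.Exports.
Local Open Scope classical_set_scope.
Local Open Scope ring_scope.

(** * Ranks of idempotent matrices *)

Section IdempotentMatrices.
Variable K : fieldType.

(** A full-rank factorization a = c d turns a a = a into c (d c) d = c d, where c cancels on the
    left and d on the right. *)
Lemma idem_base n (a : 'M[K]_n) : a *m a = a -> row_base a *m col_base a = 1%:M.
Proof.
move=> aK; apply: (row_free_inj (row_base_free a)) => /=.
apply: (row_full_inj (col_base_full a)).
by rewrite -mulmxA mulmx_base mul1mx mulmxA !mulmx_base aK.
Qed.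

Lemma mxtrace_idem n (a : 'M[K]_n) : a *m a = a -> \tr a = (\rank a)%:R.
Proof.
by move=> /idem_base aK; rewrite -{1}(mulmx_base a) mxtrace_mulC aK mxtrace1.
Qed.

(** Take full-rank factorizations a = c d and b = c' d' through the same K^r. Since d c = d' c' = 1,
    the matrices x = c d' and y = c' d work. *)
Lemma idem_rank_equiv n m (a : 'M[K]_n) (b : 'M[K]_m) :
    a *m a = a -> b *m b = b -> \rank a = \rank b ->
  exists xy : 'M[K]_(n, m) * 'M[K]_(m, n), a = xy.1 *m xy.2 /\ b = xy.2 *m xy.1.
Proof.
(* The factorizations are generalized over their inner dimensions, so that the equality of ranks can
   be eliminated without casts. *)
move=> aK bK; move: (mulmx_base a) (idem_base aK) (mulmx_base b) (idem_base bK).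
move: (col_base a) (row_base a) (col_base b) (row_base b).
move: (\rank a) (\rank b) => r q c d c' d' cd dc c'd' d'c' rq.
case: q / rq c' d' c'd' d'c' => c' d' c'd' d'c'.
exists (c *m d', c' *m d) => /=; split.
  by rewrite -mulmxA (mulmxA d') d'c' mul1mx cd.
by rewrite -mulmxA (mulmxA d) dc mul1mx c'd'.
Qed.

End IdempotentMatrices.

Lemma inj_surj_bijective (T U : Type) (f : T -> U) :
  injective f -> (forall y, exists x, f x = y) -> bijective f.
Proof.
move=> fI fS; have [g fg] := choice fS; exists g => // x.
by apply: fI; rewrite fg.
Qed.

(** * Functoriality of V *)

Section VmapTheory.
Variables (X Y : pzRingType) (f : {rmorphism X -> Y}).

Lemma Vmap_is_additive : nmod_morphism (Vmap f).
Proof.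
split=> [|u v].
  rewrite -[0 in LHS]/(Vcls (idem0 X)) VmapE; apply/VclsP => /=.
  apply: (@mvn_rect _ _ _ _ _ 0 0); apply/matrixP => i; by case: (i).
have [a ->] := Vcls_surj u; have [b ->] := Vcls_surj v.
rewrite [Vcls a + Vcls b]Vadd_block !VmapE [RHS]Vadd_block; apply/VclsP => /=.
rewrite /imx /= map_block_mx !map_mx0; apply: mvn_refl.
by apply: block_idem; apply: map_idem; exact: imxK.
Qed.

HB.instance Definition _ :=
  GRing.isNmodMorphism.Build (V X) (V Y) (Vmap f) Vmap_is_additive.

Lemma Vmap_V1 : Vmap f (V1 X) = V1 Y.
Proof.
rewrite VmapE; apply/VclsP; rewrite /imx /= map_mx1.
by apply: mvn_refl; rewrite mulmx1.
Qed.

End VmapTheory.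

(** The composite enters as a separate morphism [k], so that a map that only agrees with it
    pointwise, such as the identity or a dilation, can take its place. *)
Lemma Vmap_comp (X Y Z : pzRingType) (f : {rmorphism X -> Y})
    (g : {rmorphism Y -> Z}) (k : {rmorphism X -> Z}) :
  k =1 g \o f -> Vmap k =1 Vmap g \o Vmap f.
Proof.
move=> kE u; have [a ->] := Vcls_surj u; rewrite /= !VmapE; apply/VclsP => /=.
rewrite /imx /= -map_mx_comp -(eq_map_mx _ kE).
by apply: mvn_refl; apply: map_idem; exact: imxK.
Qed.

Lemma Vmap_id (X : pzRingType) (f : {rmorphism X -> X}) : f =1 id -> Vmap f =1 id.
Proof.
move=> fE u; have [a ->] := Vcls_surj u; rewrite VmapE; apply/VclsP => /=.
by rewrite /imx /= map_mx_id //; apply: mvn_refl; exact: (imxK a).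
Qed.

(* A multiplicative assignment of K-matrices to X-matrices, as given by a
   homomorphism from X to some M_k(K), in which case rdim n = k * n. *)
Record mxrep (X : pzRingType) (K : fieldType) := MxRep {
  rdim : nat -> nat;
  rmx :> forall m n, 'M[X]_(m, n) -> 'M[K]_(rdim m, rdim n);
  rmxM : forall m n p (x : 'M_(m, n)) (y : 'M_(n, p)),
    rmx (x *m y) = rmx x *m rmx y;
  rmx_tr : forall m n (x : 'M_m) (y : 'M_n),
    \tr (rmx (block_mx x 0 0 y)) = \tr (rmx x) + \tr (rmx y)
}.

(** * Ranks as invariants of V *)

Section RankV.
Variables (X : pzRingType) (K : numFieldType) (rho : mxrep X K).

Definition rkV (u : V X) : nat := \rank (rho _ _ (imx (repr u))).

Lemma rmx_idem n (a : 'M[X]_n) :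
  a *m a = a -> rho _ _ a *m rho _ _ a = rho _ _ a.
Proof. by move=> aK; rewrite -rmxM aK. Qed.

(** The trace is constant on equivalence classes because it is cyclic, so the rank at the chosen
    representative can be read off any idempotent of the class. In characteristic 0 the trace
    determines the rank. *)
Lemma rkVE (a : idem X) : (rkV (Vcls a))%:R = \tr (rho _ _ (imx a)).
Proof.
have [//||x [y [Ea Eb]]] := mvn_equivP _ _ (Vcls_repr a); rewrite ?imxK //.
rewrite -mxtrace_idem; last exact/rmx_idem/imxK.
by rewrite Ea Eb !rmxM mxtrace_mulC.
Qed.

Lemma rkV_is_additive : nmod_morphism rkV.
Proof.
have rkD u v : rkV (u + v) = (rkV u + rkV v)%N.
  have [a ->] := Vcls_surj u; have [b ->] := Vcls_surj v.
  apply/eqP; rewrite -(eqr_nat K) natrD [Vcls a + Vcls b]Vadd_block !rkVE.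
  by rewrite -rmx_tr.
(* The value at zero satisfies r = r + r in [nat] and is therefore 0. *)
split=> //; have := rkD 0 0; rewrite addr0 => /eqP.
by rewrite -{1}[rkV 0]addn0 eqn_add2l => /eqP.
Qed.

HB.instance Definition _ :=
  GRing.isNmodMorphism.Build (V X) nat rkV rkV_is_additive.

End RankV.

Lemma rkV_Vmap (X Y : pzRingType) (K : numFieldType) (f : {rmorphism X -> Y})
    (rho : mxrep X K) (rho' : mxrep Y K) :
  (forall n (x : 'M[X]_n), \tr (rho' _ _ (map_mx f x)) = \tr (rho _ _ x)) ->
  rkV rho' \o Vmap f =1 rkV rho.
Proof.
move=> tr_f u; have [a ->] := Vcls_surj u; rewrite /= VmapE.
by apply/eqP; rewrite -(eqr_nat K) !rkVE tr_f.
Qed.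

(** This serves homomorphisms along which [rho'] pulls back, at the level of traces, to the direct
    sum of [rho1] and [rho2]. *)
Lemma rkV_VmapD (X Y : pzRingType) (K : numFieldType) (f : {rmorphism X -> Y})
    (rho1 rho2 : mxrep X K) (rho' : mxrep Y K) :
  (forall n (x : 'M[X]_n),
    \tr (rho' _ _ (map_mx f x)) = \tr (rho1 _ _ x) + \tr (rho2 _ _ x)) ->
  forall u, rkV rho' (Vmap f u) = (rkV rho1 u + rkV rho2 u)%N.
Proof.
move=> tr_f u; have [a ->] := Vcls_surj u; rewrite VmapE.
by apply/eqP; rewrite -(eqr_nat K) natrD !rkVE tr_f.
Qed.

Section JointRank.
Variables (X : pzRingType) (K : numFieldType) (I : Type) (rho : I -> mxrep X K).
(** Together the two hypotheses identify matrices over X with families of matrices over K, as when X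
    is a finite product of matrix algebras over K. The ranks in the factors then classify
    idempotents. *)
Hypothesis rhoI : forall m n (x y : 'M[X]_(m, n)),
  (forall i, rho i _ _ x = rho i _ _ y) -> x = y.
Hypothesis rhoS : forall m n (z : forall i, 'M[K]_(rdim (rho i) m, rdim (rho i) n)),
  exists x, forall i, rho i m n x = z i.

(** In each factor equal ranks provide x and y over K. The chosen families lift to X by [rhoS], and
    the two identities hold over X because [rhoI] lets them be checked factor by factor. *)
Lemma rkV_inj u v : (forall i, rkV (rho i) u = rkV (rho i) v) -> u = v.
Proof.
have [a ->] := Vcls_surj u; have [b ->] := Vcls_surj v => rk_ab.
have xyP i : exists p : 'M[K]_(rdim (rho i) (idim a), rdim (rho i) (idim b))
    * 'M[K]_(rdim (rho i) (idim b), rdim (rho i) (idim a)),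
    rho i _ _ (imx a) = p.1 *m p.2 /\ rho i _ _ (imx b) = p.2 *m p.1.
  apply: idem_rank_equiv; rewrite ?rmx_idem ?imxK //.
  apply/eqP; rewrite -(eqr_nat K) -(mxtrace_idem (rmx_idem (rho i) (imxK a))).
  by rewrite -(mxtrace_idem (rmx_idem (rho i) (imxK b))) -!rkVE rk_ab.
pose xy i := projT1 (cid (xyP i)); have xyE i := projT2 (cid (xyP i)).
have [x xE] := rhoS (fun i => (xy i).1).
have [y yE] := rhoS (fun i => (xy i).2).
apply/VclsP; apply: (@mvn_rect _ _ _ _ _ x y);
  by apply: rhoI => i; rewrite rmxM xE yE; case: (xyE i).
Qed.

(** The idempotent is a common lift of the diagonal projections of ranks [k i]; the size n has to
    leave room for all of them at once. *)
Lemma rkV_surj n (k : I -> nat) : (forall i, (k i <= rdim (rho i) n)%N) ->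
  exists u, forall i, rkV (rho i) u = k i.
Proof.
move=> le_k; have [x xE] := rhoS (m := n) (n := n) (fun i => pid_mx (k i)).
have xK : x *m x = x.
  by apply: rhoI => i; rewrite rmxM xE pid_mx_id.
exists (Vcls (mkidem xK)) => i; apply/eqP; rewrite -(eqr_nat K) rkVE.
by rewrite mxtrace_idem ?rmx_idem // eqr_nat /imx /= xE rank_pid_mx.
Qed.

End JointRank.

(** * Star-endomorphisms of M_2(C([0,1])) *)

Section Evaluation.
Variable R : realType.
Local Notation K := (CC R).
Local Notation I01 := (unitI R).
Local Notation M2 := 'M[C01 R]_2.

Lemma unitI_mem (t : I01) : 0 <= val t <= 1.
Proof. by have := valP t; rewrite inE /= in_itv. Qed.

Lemma itv_unitI (x : R) : 0 <= x <= 1 -> x \in `[0 : R, 1 : R]%classic.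
Proof. by rewrite inE /= in_itv. Qed.

Definition ptI (x : R) (x01 : 0 <= x <= 1) : I01 := exist _ x (itv_unitI x01).

Lemma itv00 : 0 <= (0 : R) <= 1. Proof. by rewrite lexx ler01. Qed.
Lemma itv11 : 0 <= (1 : R) <= 1. Proof. by rewrite lexx ler01. Qed.
Definition I0 : I01 := ptI itv00.
Definition I1 : I01 := ptI itv11.

Definition ev (t : I01) (f : C01 R) : K := f t.
Lemma ev_is_zmod t : zmod_morphism (ev t). Proof. by []. Qed.
Lemma ev_is_monoid t : monoid_morphism (ev t). Proof. by []. Qed.
HB.instance Definition _ t :=
  GRing.isZmodMorphism.Build (C01 R) K (ev t) (ev_is_zmod t).
HB.instance Definition _ t :=
  GRing.isMonoidMorphism.Build (C01 R) K (ev t) (ev_is_monoid t).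

Lemma cst_is_zmod : zmod_morphism (@C01_cst R).
Proof. by move=> z w; apply/c01P. Qed.
Lemma cst_is_monoid : monoid_morphism (@C01_cst R).
Proof. by split=> // z w; apply/c01P. Qed.
HB.instance Definition _ :=
  GRing.isZmodMorphism.Build K (C01 R) (@C01_cst R) cst_is_zmod.
HB.instance Definition _ :=
  GRing.isMonoidMorphism.Build K (C01 R) (@C01_cst R) cst_is_monoid.

Lemma conj_is_zmod : zmod_morphism (@C01_conj R).
Proof. by move=> f g; apply/c01P => t; exact: rmorphB. Qed.
Lemma conj_is_monoid : monoid_morphism (@C01_conj R).
Proof.
by split=> [|f g]; apply/c01P => t; [exact: rmorph1|exact: rmorphM].
Qed.
HB.instance Definition _ :=
  GRing.isZmodMorphism.Build (C01 R) (C01 R) (@C01_conj R) conj_is_zmod.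
HB.instance Definition _ :=
  GRing.isMonoidMorphism.Build (C01 R) (C01 R) (@C01_conj R) conj_is_monoid.

Lemma C01_conjK : involutive (@C01_conj R).
Proof. by move=> f; apply/c01P => t; exact: conjCK. Qed.

Lemma mxstarK : involutive (@mxstar R).
Proof. by move=> a; apply/matrixP => i j; rewrite !mxE C01_conjK. Qed.

Lemma mxstarM (a b : M2) : mxstar (a * b) = mxstar b * mxstar a.
Proof. by rewrite /mxstar -[a * b]/(a *m b) trmx_mul map_mxM. Qed.

Lemma mxstarZ (f : C01 R) a : mxstar (f *: a) = C01_conj f *: mxstar a.
Proof. by rewrite /mxstar linearZ /= map_mxZ. Qed.

(** A constant [phi] gives evaluation at a point, and t |-> r t gives the homotopy on C. *)
Definition pull (phi : I01 -> I01) (phiC : continuous phi) (f : C01 R) : C01 R :=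
  c01 (fun t => continuous_comp (phiC t) (@c01_cts _ f (phi t))).


Section Pull.
Variables (phi : I01 -> I01) (phiC : continuous phi).
Lemma pull_is_zmod : zmod_morphism (pull phiC).
Proof. by move=> f g; apply/c01P. Qed.
Lemma pull_is_monoid : monoid_morphism (pull phiC).
Proof. by split=> [|f g]; apply/c01P. Qed.
HB.instance Definition _ :=
  GRing.isZmodMorphism.Build (C01 R) (C01 R) (pull phiC) pull_is_zmod.
HB.instance Definition _ :=
  GRing.isMonoidMorphism.Build (C01 R) (C01 R) (pull phiC) pull_is_monoid.
End Pull.

(** Every arrow of the diagram is the restriction of a star-endomorphism of the whole algebra, so
    linearity, multiplicativity and compatibility with the star are proved once, before
    restricting. *)
Record star_endo := StarEndo {
  endo :> {rmorphism M2 -> M2};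
  endoZ : forall (z : K) a, endo (C01_cst z *: a) = C01_cst z *: endo a;
  endoS : forall a, endo (mxstar a) = mxstar (endo a)
}.

Definition pull_endo (phi : I01 -> I01) (phiC : continuous phi) : star_endo.
Proof.
exists (map_mx (pull phiC) : {rmorphism M2 -> M2}) => [z a|a].
  by rewrite /= map_mxZ; congr (_ *: _); apply/c01P.
by apply/matrixP => i j; rewrite !mxE; apply/c01P.
Defined.

(* Conjugation by w / sqrt(w w^* ), where c = 1 / (w w^* ). *)
Section Conjugation.
Variables (w : M2) (c : C01 R).
Hypotheses (cR : C01_conj c = c) (wwS : c *: (w * mxstar w) = 1)
  (wSw : c *: (mxstar w * w) = 1).

Definition conj_by (a : M2) : M2 := c *: (w * a * mxstar w).

Lemma conj_by_is_zmod : zmod_morphism conj_by.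
Proof. by move=> a b; rewrite /conj_by mulrBr mulrBl scalerBr. Qed.

Lemma conj_by_is_monoid : monoid_morphism conj_by.
Proof.
split=> [|a b]; rewrite /conj_by ?mulr1 //.
rewrite -scalerAl -scalerAr; congr (_ *: _).
transitivity (w * a * (c *: (mxstar w * w)) * (b * mxstar w)).
  by rewrite wSw mulr1 !mulrA.
by rewrite -scalerAr -scalerAl !mulrA.
Qed.

Definition conj_endo : star_endo.
Proof.
pose F := HB.pack_for {rmorphism M2 -> M2} conj_by
  (GRing.isZmodMorphism.Build _ _ _ conj_by_is_zmod)
  (GRing.isMonoidMorphism.Build _ _ _ conj_by_is_monoid).
exists F => [z a|a] /=.
  by rewrite /conj_by -scalerAr -scalerAl !scalerA mulrC.
by rewrite /conj_by mxstarZ cR !mxstarM mxstarK mulrA.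
Defined.
End Conjugation.

End Evaluation.

(** * Subalgebras *)

Section Subalgebras.
Variable R : realType.
Local Notation K := (CC R).
Local Notation I01 := (unitI R).
Local Notation M2 := 'M[C01 R]_2.

Definition evm (t : I01) (a : M2) : 'M[K]_2 := map_mx (ev t) a.
Definition cstm (m : 'M[K]_2) : M2 := map_mx (@C01_cst R) m.

Lemma evm_cst t m : evm t (cstm m) = m.
Proof. by apply/matrixP => i j; rewrite !mxE. Qed.

Lemma evmB t a b : evm t (a - b) = evm t a - evm t b.
Proof. exact: map_mxB. Qed.
Lemma evmM t (a b : M2) : evm t (a * b) = evm t a * evm t b.
Proof. exact: map_mxM. Qed.
Lemma evm1 t : evm t 1 = 1.
Proof. exact: map_mx1. Qed.
Lemma evmZ t f a : evm t (f *: a) = f t *: evm t a.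
Proof. exact: map_mxZ. Qed.
Lemma evmS t a : evm t (mxstar a) = map_mx Num.conj (evm t a)^T.
Proof. by apply/matrixP => i j; rewrite !mxE. Qed.

Lemma cstmM m n : cstm (m * n) = cstm m * cstm n.
Proof. exact: map_mxM. Qed.

Lemma le_eps_eq0 (x : K) (c : K) : 0 <= c ->
  (forall eps, 0 < eps -> `|x| <= eps * c) -> x = 0.
Proof.
move=> c0 xc; apply/eqP; apply: contraT => x0.
have c1 : 0 < c + 1 by rewrite ltr_wpDl.
have x0' : 0 < `|x| by rewrite normr_gt0.
(* With eps = |x| / (c + 1) the bound reads |x| <= |x| c / (c + 1), which is impossible for nonzero
   x. The added 1 covers c = 0. *)
have := xc _ (divr_gt0 x0' c1); rewrite mulrAC ler_pdivlMr //.
by rewrite ler_pM2l // gerDl ler10.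
Qed.

(** An approximation b of a with L b = 0 gives |L a| = |L (a - b)| <= eps c for every eps. The
    subalgebras are intersections of zero sets of such functionals, which gives their closedness. *)
Lemma closed_lin0 (L : M2 -> K) (c : K) : 0 <= c ->
    {morph L : a b / a - b} ->
    (forall (eps : K) (a : M2), 0 < eps ->
       (forall i j t, `|a i j t| < eps) -> `|L a| <= eps * c) ->
  closed [set a | L a = 0].
Proof.
move=> c0 LB Lc; apply/closed_M2C01P => a aS /=.
apply: (le_eps_eq0 c0) => eps e0; have [b /= Lb ab] := aS _ e0.
rewrite -[L a]subr0 -Lb -LB; apply: Lc => // i j t.
by have := ab i j t; rewrite !mxE.
Qed.

Definition cst_set : set M2 := [set a | a = cstm (evm (I0 R) a)].

Lemma cst_setP a : cst_set a <-> forall i j t, a i j t = a i j (I0 R).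
Proof.
split=> [/matrixP aE i j t|aE]; first by rewrite aE !mxE.
by apply/matrixP => i j; rewrite !mxE; apply/c01P => t; exact: aE.
Qed.

Lemma closed_cst_set : closed cst_set.
Proof.
have -> : cst_set = \bigcap_(p in [set: 'I_2 * 'I_2 * I01])
    [set a : M2 | a p.1.1 p.1.2 p.2 - a p.1.1 p.1.2 (I0 R) = 0].
  apply/seteqP; split=> [a /cst_setP aE [[i j] t] _ /=|a aE].
    by rewrite aE subrr.
  apply/cst_setP => i j t; apply/eqP; rewrite -subr_eq0; apply/eqP/(aE (i, j, t) I).
refine (closed_bigI _) => -[[i j] t] _ /=.
apply: (@closed_lin0 (fun a => a i j t - a i j (I0 R)) 2%:R)
  => [//|a b|eps a e0 ae].
  rewrite !mxE -[LHS]/((a i j t - b i j t) - (a i j (I0 R) - b i j (I0 R))).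
  by rewrite !opprB [b i j _ - a i j _]addrC addrACA [- b i j _ + _]addrC.
rewrite mulr_natr mulr2n (le_trans (ler_normB _ _)) // lerD // ltW //.
Qed.

Definition csub_cst : csubalg R.
Proof.
exists cst_set; last exact: closed_cst_set; rewrite /cst_set /=.
- by rewrite evm1 /cstm map_mx1.
- by move=> a b aE bE; rewrite evmB {1}aE {1}bE /cstm map_mxB.
- by move=> a b aE bE; rewrite evmM {1}aE {1}bE cstmM.
- by move=> z a aE; rewrite evmZ {1}aE /cstm map_mxZ.
- move=> a /cst_setP aE; apply/cst_setP => i j t.
  by rewrite !mxE; exact: (congr1 Num.conj (aE j i t)).
Defined.

Section Commutant.
Variable T : set 'M[K]_2.
Hypothesis TS : forall m, T m -> T (map_mx Num.conj m^T).

(* Requiring a(0) to commute with T yields the a with a(0) scalar when T is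
   everything, and those with a(0) diagonal when T = {delta_mx 0 0}. *)
Definition comm_set : set M2 :=
  [set a | forall m, T m -> evm (I0 R) a * m = m * evm (I0 R) a].

Lemma closed_comm_set : closed comm_set.
Proof.
have -> : comm_set = \bigcap_(p in [set p : 'M[K]_2 * ('I_2 * 'I_2) | T p.1])
    [set a : M2 | (evm (I0 R) a * p.1 - p.1 * evm (I0 R) a) p.2.1 p.2.2 = 0].
  apply/seteqP; split=> [a aT [m [i j]] /= Tm|a aT m Tm].
    by rewrite aT // subrr mxE.
  apply/eqP; rewrite -subr_eq0; apply/eqP/matrixP => i j.
  by rewrite [RHS]mxE; exact: (aT (m, (i, j))).
refine (closed_bigI _) => -[m [i j]] /= _.
(* The constant adds up the moduli of the coefficients with which the entries of a(0) occur in entry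
   (i, j) of a(0) m - m a(0). *)
apply: (@closed_lin0 (fun a => (evm (I0 R) a * m - m * evm (I0 R) a) i j)
    (\sum_k (`|m k j| + `|m i k|))) => [|a b|eps a e0 ae].
- by apply: sumr_ge0 => k _; rewrite addr_ge0.
- rewrite evmB mulrBl mulrBr opprB [m * evm _ b - _]addrC addrACA.
  by rewrite [- (evm _ b * _) + _]addrC -[m * evm _ b - _]opprB mxE [X in _ + X]mxE.
- rewrite !mxE -sumrB mulr_sumr (le_trans (ler_norm_sum _ _ _)) //.
  apply: ler_sum => k _; rewrite !mxE (le_trans (ler_normB _ _)) // mulrDr.
  rewrite !normrM [`|m i k| * _]mulrC.
  by apply: lerD; rewrite ler_wpM2r //; exact/ltW/ae.
Qed.

Definition csub_comm : csubalg R.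
Proof.
exists comm_set; last exact: closed_comm_set; rewrite /comm_set /=.
- by move=> m _; rewrite evm1 mulr1 mul1r.
- by move=> a b aT bT m Tm; rewrite evmB mulrBl mulrBr aT // bT.
- by move=> a b aT bT m Tm; rewrite evmM -mulrA bT // mulrA aT // mulrA.
- by move=> z a aT m Tm; rewrite evmZ -scalerAl -scalerAr aT.
(* Since T is stable under adjoints, a(0) commutes with m^*; taking adjoints, a(0)^* commutes with
   m. *)
- move=> a aT m Tm; rewrite evmS.
  have conjK (n : 'M[K]_2) : map_mx Num.conj (map_mx Num.conj n^T)^T = n.
    by apply/matrixP => i j; rewrite !mxE conjCK.
  have conjM (n p : 'M[K]_2) : map_mx Num.conj (n * p)^T =
      map_mx Num.conj p^T * map_mx Num.conj n^T.
    by rewrite -[n * p]/(n *m p) trmx_mul map_mxM.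
  by rewrite -[m]conjK -!conjM aT //; exact: TS.
Defined.
End Commutant.

Definition csub_cap (A B : csubalg R) : csubalg R.
Proof.
exists (csa_set A `&` csa_set B).
- by split; exact: csa1.
- by move=> a b [? ?] [? ?]; split; exact: csaB.
- by move=> a b [? ?] [? ?]; split; exact: csaM.
- by move=> z a [? ?]; split; exact: csaZ.
- by move=> a [? ?]; split; exact: csaS.
- by apply: closedI; exact: csa_closed.
Defined.

Section Restriction.
Variables (A B : csubalg R) (F : star_endo R).
Hypothesis FAB : forall a, csa_set A a -> csa_set B (F a).

Lemma restr_subproof (a : A) : F (val a) \in csa_set B.
Proof. by rewrite inE; apply: FAB; apply/set_mem/(valP a). Qed.

Definition restr (a : A) : B := exist _ (F (val a)) (restr_subproof a).

Lemma restr_is_zmod : zmod_morphism restr.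
Proof. by move=> a b; apply: val_inj; rewrite /= rmorphB. Qed.
Lemma restr_is_monoid : monoid_morphism restr.
Proof.
by split=> [|a b]; apply: val_inj; rewrite /= ?rmorph1 ?rmorphM.
Qed.
Lemma restr_is_scalable : scalable restr.
Proof. by move=> z a; apply: val_inj; rewrite /= endoZ. Qed.
HB.instance Definition _ :=
  GRing.isZmodMorphism.Build A B restr restr_is_zmod.
HB.instance Definition _ :=
  GRing.isMonoidMorphism.Build A B restr restr_is_monoid.
HB.instance Definition _ :=
  GRing.isScalable.Build K A B *:%R restr restr_is_scalable.

Lemma restrS a : restr (csa_star a) = csa_star (restr a).
Proof. by apply: val_inj; rewrite /= endoS. Qed.

Definition restr_hom : star_hom A B :=
  @StarHom _ _ _ (restr : {lrmorphism A -> B}) restrS.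
End Restriction.

End Subalgebras.

(** * Matrix entries at a point as representations *)

Section Entries.
Variable R : realType.
Local Notation K := (CC R).
Local Notation I01 := (unitI R).
Local Notation M2 := 'M[C01 R]_2.

Section Ent.
Variables (X : csubalg R) (t : I01).

Definition ent (i j : 'I_2) (a : X) : K := ev t (val a i j).

Lemma ent_is_zmod i j : zmod_morphism (ent i j).
Proof. by move=> a b; rewrite /ent /= !mxE. Qed.
HB.instance Definition _ i j :=
  GRing.isZmodMorphism.Build X K (ent i j) (ent_is_zmod i j).

Lemma entM i j (a b : X) : ent i j (a * b) = \sum_l ent i l a * ent l j b.
Proof.
by rewrite /ent /= mxE rmorph_sum; apply: eq_bigr => l _; exact: rmorphM.
Qed.

Definition entmx i j m n (x : 'M[X]_(m, n)) : 'M[K]_(m, n) := map_mx (ent i j) x.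

Lemma entmxM i j m n p (x : 'M[X]_(m, n)) (y : 'M[X]_(n, p)) :
  entmx i j (x *m y) = \sum_l entmx i l x *m entmx l j y.
Proof.
apply/matrixP => k l; rewrite summxE !mxE raddf_sum /=.
under eq_bigr do rewrite entM.
rewrite exchange_big /=; apply: eq_bigr => q _; rewrite mxE.
by apply: eq_bigr => r _; rewrite !mxE.
Qed.

Lemma entmx_block i j m n (x : 'M[X]_m) (y : 'M[X]_n) :
  entmx i j (block_mx x 0 0 y) = block_mx (entmx i j x) 0 0 (entmx i j y).
Proof. by rewrite /entmx map_block_mx !map_mx0. Qed.

Lemma entmx1 i j n : entmx i j (1%:M : 'M[X]_n) = (i == j)%:R%:M.
Proof.
apply/matrixP => k l; rewrite !mxE raddfMn; congr (_ *+ _).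
by rewrite -[LHS]/(ev t ((1%:M : M2) i j)) mxE rmorph_nat.
Qed.

Section Diagonal.
Variables (i : 'I_2).
Hypothesis Xi : forall a, csa_set X a -> forall j, j != i -> a i j t = 0.

(** As row i vanishes at t off the diagonal, only the term l = i of [entmxM] survives: the entry (i,
    i) at t is a character of X. *)
Lemma diag_repM m n p (x : 'M[X]_(m, n)) (y : 'M[X]_(n, p)) :
  entmx i i (x *m y) = entmx i i x *m entmx i i y.
Proof.
rewrite entmxM (bigD1 i) //= big1 ?addr0 // => j ji.
have -> : entmx i j x = 0; last by rewrite mul0mx.
apply/matrixP => k l; rewrite !mxE; apply: Xi ji; exact/set_mem/(valP (x k l)).
Qed.

Lemma diag_rep_tr m n (x : 'M[X]_m) (y : 'M[X]_n) :
  \tr (entmx i i (block_mx x 0 0 y)) = \tr (entmx i i x) + \tr (entmx i i y).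
Proof. by rewrite entmx_block mxtrace_block. Qed.

Definition diag_rep : mxrep X K :=
  @MxRep X K id (fun m n => @entmx i i m n) diag_repM diag_rep_tr.
End Diagonal.

(** This is evaluation at t followed by the identification of matrices over M_2(K) with 2 x 2 block
    matrices over K, the index of M_2 being made the outer one. *)
Definition blockmx m n (x : 'M[X]_(m, n)) : 'M[K]_(m + m, n + n) :=
  block_mx (entmx 0 0 x) (entmx 0 1 x) (entmx 1 0 x) (entmx 1 1 x).

Lemma blockmxM m n p (x : 'M[X]_(m, n)) (y : 'M[X]_(n, p)) :
  blockmx (x *m y) = blockmx x *m blockmx y.
Proof.
have sum2 n1 n2 (F : 'I_2 -> 'M[K]_(n1, n2)) : \sum_l F l = F 0 + F 1.
  by rewrite !big_ord_recl big_ord0 addr0; congr (_ + F _); apply: val_inj.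
by rewrite /blockmx mulmx_block !entmxM !sum2.
Qed.

Lemma blockmx_tr m n (x : 'M[X]_m) (y : 'M[X]_n) :
  \tr (blockmx (block_mx x 0 0 y)) = \tr (blockmx x) + \tr (blockmx y).
Proof. by rewrite /blockmx !mxtrace_block !entmx_block !mxtrace_block addrACA. Qed.

Definition block_rep : mxrep X K :=
  @MxRep X K (fun n => n + n)%N blockmx blockmxM blockmx_tr.

End Ent.

(** Elements of an algebra of constant matrices are determined by their values at 0. *)
Lemma entmx_inj (X : csubalg R) m n (x y : 'M[X]_(m, n)) :
    csa_set X `<=` csa_set (csub_cst R) ->
  (forall i j, entmx (I0 R) i j x = entmx (I0 R) i j y) -> x = y.
Proof.
move=> Xc xy; apply/matrixP => k l; apply: val_inj.
rewrite (Xc _ (set_mem (valP (x k l)))) (Xc _ (set_mem (valP (y k l)))).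
congr cstm; apply/matrixP => i j; rewrite !mxE.
by have /matrixP/(_ k l) := xy i j; rewrite !mxE.
Qed.

Lemma entmx_surj (X : csubalg R) m n (z : 'I_2 -> 'I_2 -> 'M[K]_(m, n)) :
    (forall k l, csa_set X (cstm (\matrix_(i, j) z i j k l))) ->
  exists x : 'M[X]_(m, n), forall t i j, entmx t i j x = z i j.
Proof.
move=> Xz; exists (\matrix_(k, l) exist _ (cstm (\matrix_(i, j) z i j k l))
  (mem_set (Xz k l)) : 'M[X]_(m, n)) => t i j.
by apply/matrixP => k l; rewrite !mxE /ent /= !mxE.
Qed.

Lemma mulmx_delta (k l : 'I_2) (a : 'M[K]_2) i j :
  (a * delta_mx k l) i j = a i k *+ (j == l).
Proof.
rewrite mxE (bigD1 k) //= mxE eqxx /= big1 ?addr0 => [|q qk].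
  by rewrite mulr_natr.
by rewrite mxE (negbTE qk) mulr0.
Qed.

Lemma delta_mulmx (k l : 'I_2) (a : 'M[K]_2) i j :
  (delta_mx k l * a) i j = a l j *+ (i == k).
Proof.
rewrite mxE (bigD1 l) //= mxE eqxx andbT /= big1 ?addr0 => [|q ql].
  by rewrite mulr_natl.
by rewrite mxE (negbTE ql) andbF mul0r.
Qed.

Lemma delta_star_subproof : forall m, [set delta_mx 0 0] m ->
  [set delta_mx 0 0 : 'M[K]_2] (map_mx Num.conj m^T).
Proof. by move=> m /= ->; rewrite trmx_delta map_delta_mx. Qed.

Definition diag0 : csubalg R := csub_comm delta_star_subproof.
Definition scal0 : csubalg R :=
  @csub_comm R [set: 'M[K]_2] (fun _ _ => Logic.I).

(** The off-diagonal entries of a(0) E_00 = E_00 a(0) say exactly that a_10(0) = 0 and a_01(0) =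
    0. *)
Lemma diag0P a : csa_set diag0 a <->
  (forall i j, i != j -> a i j (I0 R) = 0).
Proof.
split=> [aC i j ij|aD m /= ->].
  have /matrixP E : evm (I0 R) a * delta_mx 0 0 = delta_mx 0 0 * evm (I0 R) a.
    exact: aC.
  have := E i j; rewrite mulmx_delta delta_mulmx !mxE.
  case: i j ij {E} => [[|[|//]] pi] [[|[|//]] pj] //= _.
    rewrite mulr0n mulr1n => /esym; rewrite /ev; congr (_ = 0).
    by congr (fun_of_C01 (a _ _) _); apply: val_inj.
  rewrite mulr0n mulr1n; congr (_ = 0).
  by congr (fun_of_C01 (a _ _) _); apply: val_inj.
apply/matrixP => i j; rewrite mulmx_delta delta_mulmx !mxE /ev.
have [->|i0] := eqVneq i 0; have [->|j0] := eqVneq j 0 => //=.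
  by have -> : a 0 j (I0 R) = 0 by apply: aD; rewrite eq_sym.
by rewrite aD.
Qed.

(** Commuting with all matrix units E_kl forces a(0) into the centre of M_2(K), the scalar
    matrices. *)
Lemma scal0P a : csa_set scal0 a <-> evm (I0 R) a = (a 0 0 (I0 R))%:M.
Proof.
split=> [aC|aE m _]; last by rewrite aE; apply/esym/scalar_mxC.
have E k l i j : a i k (I0 R) *+ (j == l) = a l j (I0 R) *+ (i == k).
  have /matrixP/(_ i j) := aC (delta_mx k l) Logic.I.
  by rewrite mulmx_delta delta_mulmx !mxE.
apply/matrixP => i j; rewrite !mxE /ev.
have [<-|ij] := eqVneq i j; first by have := E i 0 i 0; rewrite !eqxx.
by have := E j i i i; rewrite eqxx (negbTE ij) mulr1n.
Qed.

Lemma scal0_diag0 : csa_set scal0 `<=` csa_set diag0.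
Proof. by move=> a aC m _; exact: aC. Qed.

End Entries.

Lemma ord2_cases (k : 'I_2) : k = 0 \/ k = 1.
Proof. by case: k => [[|[|//]] pk]; [left|right]; apply: val_inj. Qed.

(** * The monoids V of A, B and D *)

Section Ranks.
Variable R : realType.
Local Notation K := (CC R).
Local Notation cstA := (csub_cst R).

Definition algA : csubalg R := csub_cap cstA (scal0 R).
Definition algB : csubalg R := csub_cap cstA (diag0 R).
Definition algC : csubalg R := diag0 R.
Definition algD : csubalg R := cstA.

Lemma algBC : csa_set algB `<=` csa_set algC. Proof. by move=> a []. Qed.
Lemma algAB : csa_set algA `<=` csa_set algB.
Proof. by move=> a [ac /scal0_diag0]; split. Qed.

Lemma algB_row0 i a : csa_set algB a -> forall j, j != i -> a i j (I0 R) = 0.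
Proof. by move=> /algBC/diag0P aD j ji; apply: aD; rewrite eq_sym. Qed.

Lemma cstm_cst (m : 'M[K]_2) : csa_set cstA (cstm m).
Proof. by rewrite /= /cst_set /= evm_cst. Qed.

(** A is K by its entry (0, 0), B is K x K by its two diagonal entries, and D is M_2(K) by its value
    at 0. The index type [unit] presents a single factor as a family. *)
Definition repA (_ : unit) : mxrep algA K :=
  diag_rep (fun a aA => @algB_row0 0 a (algAB aA)).
Definition repB (i : 'I_2) : mxrep algB K := diag_rep (@algB_row0 i).
Definition repD (_ : unit) : mxrep algD K := block_rep algD (I0 R).

Lemma repA_inj m n (x y : 'M[algA]_(m, n)) :
  (forall i, repA i _ _ x = repA i _ _ y) -> x = y.
Proof.
move=> /(_ tt) /= /matrixP xy; apply: entmx_inj => [a []//|i j].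
apply/matrixP => k l; have := xy k l; rewrite !mxE /ent => xy00.
have entE (a : algA) : ev (I0 R) (val a i j) = ev (I0 R) (val a 0 0) *+ (i == j).
  have [_ /scal0P/matrixP/(_ i j)] := set_mem (valP a).
  by rewrite !mxE.
by rewrite !entE xy00.
Qed.

Lemma repA_surj m n (z : forall i, 'M[K]_(rdim (repA i) m, rdim (repA i) n)) :
  exists x : 'M[algA]_(m, n), forall i, repA i m n x = z i.
Proof.
have [|x xE] := @entmx_surj R algA m n (fun i j => (i == j)%:R *: z tt).
  move=> k l; split; first exact: cstm_cst.
  apply/scal0P/matrixP => i j; rewrite !mxE eqxx mul1r.
  exact: mulr_natl.
by exists x => -[]; rewrite [LHS]xE scale1r.
Qed.

Lemma repB_inj m n (x y : 'M[algB]_(m, n)) :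
  (forall i, repB i _ _ x = repB i _ _ y) -> x = y.
Proof.
move=> xy; apply: entmx_inj => [a []//|i j].
have [<-|ij] := eqVneq i j; first exact: xy.
apply/matrixP => k l; rewrite !mxE /ent.
have ent0 (a : algB) : ev (I0 R) (val a i j) = 0.
  by apply: (algB_row0 (set_mem (valP a))); rewrite eq_sym.
by rewrite !ent0.
Qed.

Lemma repB_surj m n (z : forall i, 'M[K]_(rdim (repB i) m, rdim (repB i) n)) :
  exists x : 'M[algB]_(m, n), forall i, repB i m n x = z i.
Proof.
have [|x xE] := @entmx_surj R algB m n (fun i j => (i == j)%:R *: z i).
  move=> k l; split; first exact: cstm_cst.
  by apply/diag0P => i j ij; rewrite !mxE (negbTE ij) mul0r.
by exists x => i; rewrite [LHS]xE eqxx scale1r.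
Qed.

Lemma repD_inj m n (x y : 'M[algD]_(m, n)) :
  (forall i, repD i _ _ x = repD i _ _ y) -> x = y.
Proof.
move=> /(_ tt) /eq_block_mx[xy00 xy01 xy10 xy11]; apply: entmx_inj => [//|i j].
by have [->|->] := ord2_cases i; have [->|->] := ord2_cases j.
Qed.

Lemma repD_surj m n (z : forall i, 'M[K]_(rdim (repD i) m, rdim (repD i) n)) :
  exists x : 'M[algD]_(m, n), forall i, repD i m n x = z i.
Proof.
pose z0 : 'M[K]_(m + m, n + n) := z tt.
have [|x xE] := @entmx_surj R algD m n (fun i j =>
    if i == 0 then if j == 0 then ulsubmx z0 else ursubmx z0
              else if j == 0 then dlsubmx z0 else drsubmx z0).
  by move=> k l; exact: cstm_cst.
by exists x => -[]; rewrite -[LHS]/(blockmx (I0 R) x) /blockmx !xE /= submxK.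
Qed.

Definition etaA : V algA -> nat := rkV (repA tt).
Definition etaB (u : V algB) : nat * nat := (rkV (repB 0) u, rkV (repB 1) u).
Definition etaD : V algD -> nat := rkV (repD tt).

HB.instance Definition _ := GRing.Additive.on etaA.
HB.instance Definition _ := GRing.Additive.on etaD.

Lemma etaB_is_additive : nmod_morphism etaB.
Proof. by split=> [|u v]; rewrite /etaB ?raddf0 // !raddfD. Qed.
HB.instance Definition _ :=
  GRing.isNmodMorphism.Build (V algB) (nat * nat)%type etaB etaB_is_additive.

Lemma etaA_iso : ou_iso (V1 algA) 1%N etaA.
Proof.
split.
  apply: inj_surj_bijective => [u v uv|k].
    by apply: (rkV_inj repA_inj repA_surj) => -[].
  have [u uE] := rkV_surj repA_inj repA_surj (n := k) (k := fun _ => k)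
    (fun _ => leqnn k).
  by exists u; exact: uE.
apply/eqP; rewrite -(eqr_nat K) rkVE /imx /=.
by rewrite [X in \tr X]entmx1 mxtrace1.
Qed.

Lemma etaB_iso : ou_iso (V1 algB) (1%N, 1%N) etaB.
Proof.
split.
  apply: inj_surj_bijective => [u v [uv0 uv1]|[k l]].
    apply: (rkV_inj repB_inj repB_surj) => i.
    by have [->|->] := ord2_cases i.
  (* Size [maxn k l] holds a projection of rank k in one factor and one of rank l in the other. *)
  have [|u uE] := rkV_surj repB_inj repB_surj (n := maxn k l)
    (k := fun i => if i == 0 then k else l).
    by move=> i; case: ifP => _; rewrite ?leq_maxl ?leq_maxr.
  by exists u; congr (_, _); [exact: (uE 0)|exact: (uE 1)].
have rk1 i : rkV (repB i) (V1 algB) = 1%N.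
  apply/eqP; rewrite -(eqr_nat K) rkVE /imx /=.
  by rewrite [X in \tr X]entmx1 eqxx mxtrace1.
exact: (congr2 pair (rk1 0) (rk1 1)).
Qed.

Lemma etaD_iso : ou_iso (V1 algD) 2%N etaD.
Proof.
split.
  apply: inj_surj_bijective => [u v uv|k].
    by apply: (rkV_inj repD_inj repD_surj) => -[].
  have [u uE] := rkV_surj repD_inj repD_surj (n := k) (k := fun _ => k)
    (fun _ => leq_addr k k).
  by exists u; exact: uE.
apply/eqP; rewrite -(eqr_nat K) rkVE /imx /=.
by rewrite [X in \tr X]/blockmx !entmx1 mxtrace_block mxtrace1 -natrD.
Qed.

End Ranks.

(** * Homotopy of idempotents *)

(* z = b c + (1 - b)(1 - c) satisfies b z = b c = z c. *)
Lemma idem_unit_equiv (X : pzRingType) n (b c z' : 'M[X]_n) :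
    b *m b = b -> c *m c = c ->
    (b *m c + (1%:M - b) *m (1%:M - c)) *m z' = 1%:M ->
    z' *m (b *m c + (1%:M - b) *m (1%:M - c)) = 1%:M ->
  mvn_equiv b c.
Proof.
move=> bK cK; set z := (b *m c + _) => zz' z'z.
have bz : b *m z = b *m c.
  rewrite mulmxDr !mulmxA bK (_ : b *m (1%:M - b) = 0) ?mul0mx ?addr0 //.
  by rewrite mulmxBr mulmx1 bK subrr.
have zc : z *m c = b *m c.
  rewrite mulmxDl -!mulmxA cK (_ : (1%:M - c) *m c = 0) ?mulmx0 ?addr0 //.
  by rewrite mulmxBl mul1mx cK subrr.
apply: (@mvn_rect _ _ _ _ _ (z *m c) (z' *m b)).
  by rewrite zc -bz -mulmxA [z *m _]mulmxA zz' mul1mx bK.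
by rewrite -mulmxA [b *m (z *m c)]mulmxA bz -mulmxA cK -zc mulmxA z'z mul1mx.
Qed.

(** * Continuity of determinants and inverses *)

Section ContinuousMatrices.
Variables (T : topologicalType) (K : numClosedFieldType).

Definition mxcts m n (A : T -> 'M[K]_(m, n)) :=
  forall i j, continuous (fun t => A t i j).

Lemma cts_ext (f g : T -> K) : continuous f -> f =1 g -> continuous g.
Proof. by move=> cf /funext <-. Qed.

Lemma cts_sum (J : Type) (r : seq J) (P : pred J) (F : J -> T -> K) :
  (forall j, continuous (F j)) -> continuous (fun t => \sum_(j <- r | P j) F j t).
Proof.
move=> cF; elim: r => [|j r IH].
  by refine (cts_ext (@cts_cst T K 0) _) => t; rewrite big_nil.
case Pj: (P j); last by refine (cts_ext IH _) => t; rewrite big_cons Pj.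
by refine (cts_ext (cts_add (cF j) IH) _) => t; rewrite big_cons Pj.
Qed.

Lemma cts_prod (J : Type) (r : seq J) (P : pred J) (F : J -> T -> K) :
  (forall j, continuous (F j)) -> continuous (fun t => \prod_(j <- r | P j) F j t).
Proof.
move=> cF; elim: r => [|j r IH].
  by refine (cts_ext (@cts_cst T K 1) _) => t; rewrite big_nil.
case Pj: (P j); last by refine (cts_ext IH _) => t; rewrite big_cons Pj.
by refine (cts_ext (cts_mul (cF j) IH) _) => t; rewrite big_cons Pj.
Qed.

Lemma mxcts_cst m n (A : 'M[K]_(m, n)) : mxcts (fun=> A).
Proof. by move=> i j; exact: cts_cst. Qed.

Lemma mxcts_add m n (A B : T -> 'M[K]_(m, n)) :
  mxcts A -> mxcts B -> mxcts (fun t => A t + B t).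
Proof.
move=> cA cB i j; refine (cts_ext (cts_add (cA i j) (cB i j)) _) => t.
by rewrite mxE.
Qed.

Lemma mxcts_opp m n (A : T -> 'M[K]_(m, n)) : mxcts A -> mxcts (fun t => - A t).
Proof.
by move=> cA i j; refine (cts_ext (cts_opp (cA i j)) _) => t; rewrite mxE.
Qed.

Lemma mxcts_mul m n p (A : T -> 'M[K]_(m, n)) (B : T -> 'M[K]_(n, p)) :
  mxcts A -> mxcts B -> mxcts (fun t => A t *m B t).
Proof.
move=> cA cB i j.
have cAB k := cts_mul (cA i k) (cB k j).
refine (cts_ext (@cts_sum _ (index_enum _) predT _ cAB) _) => t.
by rewrite mxE.
Qed.

Lemma cts_det n (A : T -> 'M[K]_n) : mxcts A -> continuous (fun t => \det (A t)).
Proof.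
move=> cA; apply: cts_sum => s; apply: cts_mul; first exact: cts_cst.
by apply: cts_prod => i; exact: cA.
Qed.

(** By Cramer's rule the entries of the inverse are cofactors divided by the determinant. *)
Lemma mxcts_inv n (A : T -> 'M[K]_n) : mxcts A ->
  (forall t, \det (A t) != 0) -> mxcts (fun t => invmx (A t)).
Proof.
move=> cA A0 i j.
have cM : mxcts (fun t => row' j (col' i (A t))).
  by move=> k l; refine (cts_ext (cA (lift j k) (lift i l)) _) => t; rewrite !mxE.
have cV : continuous (fun t => (\det (A t))^-1).
  by move=> t; apply: cvgV (A0 t) _; exact: cts_det.
have cC := cts_mul (@cts_cst T K ((-1) ^+ (j + i))) (cts_det cM).
refine (cts_ext (cts_mul cV cC) _).
by move=> t; rewrite /invmx unitmxE unitfE A0 !mxE.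
Qed.

End ContinuousMatrices.

(** * Invertibility over C and the dilation homotopy *)

Section Homotopy.
Variable R : realType.
Local Notation K := (CC R).
Local Notation I01 := (unitI R).
Local Notation algC := (algC R).

Lemma nbhs_unitIP (t : I01) (U : set I01) : nbhs t U <->
  exists2 e : R, 0 < e & forall s : I01, `|val s - val t| < e -> U s.
Proof.
rewrite (@nbhs_ballP R (`[0 : R, 1 : R]%classic : pseudoMetricType R) t U).
split=> -[e /= e0 eU]; exists e => // s st; apply: eU.
  by rewrite /ball /= /initial_ball /ball /= distrC.
by move: st; rewrite /ball /= /initial_ball /ball /= distrC.
Qed.

Definition half n (i : 'I_2) (k : 'I_n) : 'I_(n + n) :=
  if i == 0 then lshift n k else rshift n k.

Lemma blockmxE (X : csubalg R) t m n (x : 'M[X]_(m, n)) i j k l :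
  blockmx t x (half i k) (half j l) = ent t i j (x k l).
Proof.
rewrite /half; have [->|->] := ord2_cases i; have [->|->] := ord2_cases j => /=.
- by rewrite block_mxEul mxE.
- by rewrite block_mxEur mxE.
- by rewrite block_mxEdl mxE.
- by rewrite block_mxEdr mxE.
Qed.

Lemma halfP n (k : 'I_(n + n)) : exists i l, k = half i l.
Proof.
by case: (splitP k) => l kE; [exists 0, l|exists 1, l]; apply: val_inj.
Qed.

Lemma mxcts_blockmx (X : csubalg R) m n (x : 'M[X]_(m, n)) :
  mxcts (fun t => blockmx t x).
Proof.
move=> k l; have [i [p ->]] := halfP k; have [j [q ->]] := halfP l.
refine (cts_ext (@c01_cts _ (val (x p q) i j)) _) => t.
by rewrite blockmxE.
Qed.

Lemma blockmx_inj (X : csubalg R) m n (x y : 'M[X]_(m, n)) :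
  (forall t, blockmx t x = blockmx t y) -> x = y.
Proof.
move=> xy; apply/matrixP => k l; apply/val_inj/matrixP => i j; apply/c01P => t.
by have /matrixP/(_ (half i k) (half j l)) := xy t; rewrite !blockmxE.
Qed.

Lemma blockmxD (X : csubalg R) t m n (x y : 'M[X]_(m, n)) :
  blockmx t (x + y) = blockmx t x + blockmx t y.
Proof. by rewrite /blockmx /entmx !map_mxD add_block_mx. Qed.

Lemma blockmxN (X : csubalg R) t m n (x : 'M[X]_(m, n)) :
  blockmx t (- x) = - blockmx t x.
Proof. by rewrite /blockmx /entmx !map_mxN opp_block_mx. Qed.

Lemma blockmx1 (X : csubalg R) t n : blockmx t (1%:M : 'M[X]_n) = 1%:M.
Proof. by rewrite /blockmx !entmx1 /= raddf0 -scalar_mx_block. Qed.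

(** The pointwise inverse is continuous by [mxcts_inv]. At 0 the blocks of z off the diagonal
    vanish, so the inverse is block diagonal there as well, and its entries lie in C. *)
Lemma algC_unit n (z : 'M[algC]_n) : (forall t, \det (blockmx t z) != 0) ->
  exists2 z' : 'M[algC]_n, z *m z' = 1%:M & z' *m z = 1%:M.
Proof.
move=> z0; have zU t : blockmx t z \in unitmx by rewrite unitmxE unitfE.
have cW := mxcts_inv (@mxcts_blockmx _ _ _ z) z0.
pose W k l : 'M[C01 R]_2 := \matrix_(i, j) c01 (cW (half i k) (half j l)).
have WC k l : csa_set algC (W k l).
  apply/diag0P => i j ij; rewrite mxE.
  rewrite -[LHS]/(invmx (blockmx (I0 R) z) (half i k) (half j l)).
  have z00 i' j' : i' != j' -> entmx (I0 R) i' j' z = 0.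
    move=> ij'; apply/matrixP => p q; rewrite !mxE.
    by have /diag0P := set_mem (valP (z p q)); apply.
  have zE : blockmx (I0 R) z =
      block_mx (entmx (I0 R) 0 0 z) 0 0 (entmx (I0 R) 1 1 z).
    by rewrite /blockmx (z00 0 1) // (z00 1 0).
  have := zU (I0 R); rewrite !zE => zU0; rewrite invmx_block_diag //.
  have [iE|iE] := ord2_cases i; have [jE|jE] := ord2_cases j;
    move: ij; rewrite iE jE // => _; rewrite /half /=.
    by rewrite block_mxEur mxE.
  by rewrite block_mxEdl mxE.
pose z' : 'M[algC]_n := \matrix_(k, l) exist _ (W k l) (mem_set (WC k l)).
have z'E t : blockmx t z' = invmx (blockmx t z).
  apply/matrixP => k l; have [i [p ->]] := halfP k; have [j [q ->]] := halfP l.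
  by rewrite blockmxE mxE /ent /= mxE.
exists z'; apply: blockmx_inj => t; rewrite blockmxM z'E blockmx1.
  exact: mulmxV.
exact: mulVmx.
Qed.

Lemma scaleI_subproof (r t : I01) : 0 <= val r * val t <= 1.
Proof.
have /andP[r0 r1] := unitI_mem r; have /andP[t0 t1] := unitI_mem t.
by rewrite mulr_ge0 //= mulr_ile1.
Qed.

Definition scaleI (r t : I01) : I01 := ptI (scaleI_subproof r t).

Lemma val_unitI_cts : continuous (fun t : I01 => val t : R).
Proof. exact: (@initial_continuous _ R set_val). Qed.

Lemma scaleI_cts r : continuous (scaleI r).
Proof.
refine (@continuous_comp_initial _ I01 R set_val (scaleI r) _) => t.
apply: (@continuousM R I01 (fun=> val r) (fun s => val s) t).
  exact: cst_continuous.
exact: val_unitI_cts.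
Qed.

Lemma scaleI0 r : scaleI r (I0 R) = I0 R.
Proof. by apply: val_inj; rewrite /= mulr0. Qed.

(** The dilation t |-> r t fixes 0, the only point where membership in C is a condition. *)
Lemma scale_algC r a : csa_set algC a -> csa_set algC (pull_endo (@scaleI_cts r) a).
Proof.
move=> /diag0P aD; apply/diag0P => i j ij; rewrite mxE.
by rewrite -[LHS]/(a i j (scaleI r (I0 R))) scaleI0 aD.
Qed.

Definition scaleC r : star_hom algC algC := restr_hom (@scale_algC r).

Lemma blockmx_scale r t n (a : 'M[algC]_n) :
  blockmx t (map_mx (scaleC r) a) = blockmx (scaleI r t) a.
Proof.
apply/matrixP => k l; have [i [p ->]] := halfP k; have [j [q ->]] := halfP l.
by rewrite !blockmxE mxE /ent /= mxE.
Qed.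

Section Path.
Variables (n : nat) (a : 'M[algC]_n).
Hypothesis aK : a *m a = a.

(** This is the element z of [idem_unit_equiv] for b = a(s) and c = a(t), taken as a function of
    both points so that compactness can make its invertibility uniform. *)
Definition transporter (st : I01 * I01) : 'M[K]_(n + n) :=
  blockmx st.1 a *m blockmx st.2 a +
  (1%:M - blockmx st.1 a) *m (1%:M - blockmx st.2 a).

Lemma transporter_det_cts : continuous (fun st => \det (transporter st)).
Proof.
have c1 : mxcts (fun st : I01 * I01 => blockmx st.1 a).
  move=> i j st; apply: (@continuous_comp _ _ _ fst (fun t => blockmx t a i j)).
    exact: cvg_fst.
  exact: mxcts_blockmx.
have c2 : mxcts (fun st : I01 * I01 => blockmx st.2 a).
  move=> i j st; apply: (@continuous_comp _ _ _ snd (fun t => blockmx t a i j)).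
    exact: cvg_snd.
  exact: mxcts_blockmx.
have d1 := mxcts_add (@mxcts_cst _ K _ _ 1%:M) (mxcts_opp c1).
have d2 := mxcts_add (@mxcts_cst _ K _ _ 1%:M) (mxcts_opp c2).
exact: (@cts_det _ K _ transporter (mxcts_add (mxcts_mul c1 c2) (mxcts_mul d1 d2))).
Qed.

(** For b = c the element z is b^2 + (1 - b)^2 = b + (1 - b). *)
Lemma transporter_diag t : transporter (t, t) = 1%:M.
Proof.
have AK : blockmx t a *m blockmx t a = blockmx t a by rewrite -blockmxM aK.
rewrite /transporter /= !(mulmxBl, mulmxBr, mul1mx, mulmx1) AK subrr subr0.
by rewrite addrC subrK.
Qed.

(** The determinant is continuous and equals 1 on the diagonal, so it is nonzero near each (x, x);
    compactness of [0, 1] yields one width d for all points. *)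
Lemma transporter_unit : exists2 d : R, 0 < d & forall s t : I01,
  `|val s - val t| < d -> \det (transporter (s, t)) != 0.
Proof.
pose P (d x : R) := forall s t : I01, `|val s - x| < d -> `|val t - x| < d ->
  \det (transporter (s, t)) != 0.
have : \forall d \near 0^'+, `[0 : R, 1 : R]%classic `<=` P d.
  have /compact_near_coveringP := @segment_compact R 0 1; apply.
  move=> x; rewrite /= in_itv /= => x01; pose t : I01 := ptI x01.
  have D1 : \det (transporter (t, t)) != 0.
    by rewrite transporter_diag det1 oner_neq0.
  have [[U V] /= [/nbhs_unitIP[e e0 eU] /nbhs_unitIP[e' e'0 eV]] UV] :=
    cvgr_neq0 _ (@transporter_det_cts (t, t)) D1.
  (* Half of the radius is spent on the distance from x to y, the other half on the distance d from
     y to the two points. *)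
  pose e2 := Num.min e e' / 2.
  have e20 : 0 < e2 by rewrite divr_gt0 // lt_min e0.
  exists (ball x e2, [set d | d < e2]) => /=.
    split; first exact: nbhsx_ballx.
    exact: nbhs_right_lt.
  move=> [y d] /= [xy de] s t' sy ty.
  have close (p : I01) : `|val p - y| < d -> `|val p - x| < Num.min e e'.
    move=> py; rewrite -(subrKA y) (le_lt_trans (ler_normD _ _)) //.
    rewrite [ltRHS]splitr ltrD ?(lt_trans py de) // distrC.
    exact: xy.
  apply: (UV (s, t')); split => /=.
  - by apply: eU; apply: lt_le_trans (close s sy) _; rewrite ge_min lexx.
  - by apply: eV; apply: lt_le_trans (close t' ty) _; rewrite ge_min lexx orbT.
move=> /(filterI (nbhs_right_gt 0)) /filter_ex [d [/= d0 dP]].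
exists d => // s t st; apply: (dP (val t)) => //.
  by rewrite /= in_itv /= unitI_mem.
by rewrite subrr normr0.
Qed.

(** Since 0 <= t <= 1, the points r t and r' t are at most |r - r'| apart, so the transporter
    between the two dilates of a is invertible at every t and [algC_unit] inverts it inside C. *)
Lemma scale_equiv_near : exists2 d : R, 0 < d & forall r r' : I01,
  `|val r - val r'| < d ->
  mvn_equiv (map_mx (scaleC r) a) (map_mx (scaleC r') a).
Proof.
have [d d0 dP] := transporter_unit; exists d => // r r' rr'.
set b := map_mx _ a; set c := map_mx _ a.
have bK : b *m b = b by rewrite -map_mxM aK.
have cK : c *m c = c by rewrite -map_mxM aK.
pose z := b *m c + (1%:M - b) *m (1%:M - c).
have [t|z' zz' z'z] := @algC_unit n z.
  rewrite !(blockmxD, blockmxM, blockmxN, blockmx1) !blockmx_scale.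
  apply: (dP (scaleI r t) (scaleI r' t)).
  have /andP[t0 t1] := unitI_mem t.
  rewrite /= -mulrBl normrM (ger0_norm t0).
  by rewrite (le_lt_trans _ rr') // ler_piMr.
exact: (idem_unit_equiv bK cK zz' z'z).
Qed.

Lemma scale_equiv : mvn_equiv a (map_mx (scaleC (I0 R)) a).
Proof.
have [d d0 dP] := scale_equiv_near.
have d20 : 0 < d / 2 by rewrite divr_gt0.
have ide (r : I01) :
    map_mx (scaleC r) a *m map_mx (scaleC r) a = map_mx (scaleC r) a.
  by rewrite -map_mxM aK.
(* The induction walks down from r in k steps of length d / 2, which is strictly less than d; once r
   is at most d / 2, a single step leads to 0. *)
have main k (r : I01) : val r <= (d / 2) *+ k ->
    mvn_equiv (map_mx (scaleC r) a) (map_mx (scaleC (I0 R)) a).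
  elim: k r => [|k IH] r rk; have /andP[r0 r1] := unitI_mem r.
    have -> : r = I0 R by apply: val_inj; apply/eqP; rewrite /= eq_le r0 andbT.
    exact: mvn_refl.
  have [rd|rd] := leP (val r) (d / 2).
    apply: dP; rewrite /= subr0 ger0_norm // (le_lt_trans rd) //.
    by rewrite ltr_pdivrMr // ltr_pMr // ltr1n.
  have r01 : 0 <= val r - d / 2 <= 1.
    by rewrite subr_ge0 (ltW rd) (le_trans _ r1) // gerBl ltW.
  apply: (@mvn_trans _ _ _ _ _ (map_mx (scaleC (ptI r01)) a)) => //.
    apply: dP; rewrite /= opprB addrC subrK ger0_norm ?ltW //.
    by rewrite ltr_pdivrMr // ltr_pMr // ltr1n.
  by apply: IH; rewrite /= lerBlDr -mulrSr.
(* More than 2 / d steps cover the whole way from r = 1, where the dilation is the identity. *)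
have : mvn_equiv (map_mx (scaleC (I1 R)) a) (map_mx (scaleC (I0 R)) a).
  apply: (main (Num.truncn (d / 2)^-1).+1).
  by rewrite /= -mulr_natr mulrC -ler_pdivrMr // div1r ltW // truncnS_gt.
rewrite (_ : map_mx (scaleC (I1 R)) a = a) //.
apply: blockmx_inj => t; rewrite blockmx_scale; congr (blockmx _ a).
by apply: val_inj; rewrite /= mul1r.
Qed.

End Path.
End Homotopy.

(** * The diagram *)

Section Rotation.
Variable R : realType.
Local Notation K := (CC R).
Local Notation I01 := (unitI R).
Local Notation M2 := 'M[C01 R]_2.

Definition toCC (x : R) : K := (x%:C)%C.

Lemma toCC_norm (x : R) : `|toCC x| = toCC `|x|.
Proof. by rewrite normc_def /= expr0n addr0 sqrtr_sqr. Qed.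

Lemma toCC_is_zmod : zmod_morphism toCC. Proof. exact: rmorphB. Qed.
HB.instance Definition _ := GRing.isZmodMorphism.Build R K toCC toCC_is_zmod.

Lemma toCC_cts : continuous toCC.
Proof.
(* A positive e in the order of K has zero imaginary part, so its real part serves as the radius in
   R. *)
move=> x; apply/cvgrPdist_lt => e; rewrite ltcE /= => /andP[/eqP Ime Ree].
have /cvgrPdist_lt/(_ _ Ree) : y @[y --> x] --> x by exact: cvg_id.
apply: filterS => y xy; rewrite -raddfB toCC_norm ltcE /= xy andbT.
by rewrite Ime.
Qed.

Definition mx2 (S : Type) (a b c d : S) : 'M[S]_2 :=
  \matrix_(i, j) if i == 0 then if j == 0 then a else b
                 else if j == 0 then c else d.

Lemma mx2_eta (S : Type) (m : 'M[S]_2) : m = mx2 (m 0 0) (m 0 1) (m 1 0) (m 1 1).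
Proof.
apply/matrixP => i j; rewrite mxE.
by have [->|->] := ord2_cases i; have [->|->] := ord2_cases j.
Qed.

Lemma mx2M (S : pzRingType) (a b c d a' b' c' d' : S) :
  mx2 a b c d * mx2 a' b' c' d' =
  mx2 (a * a' + b * c') (a * b' + b * d') (c * a' + d * c') (c * b' + d * d').
Proof.
apply/matrixP => i j; rewrite mxE !big_ord_recl big_ord0 addr0 !mxE.
by have [->|->] := ord2_cases i; have [->|->] := ord2_cases j.
Qed.

Lemma mxstar2 (a b c d : C01 R) : mxstar (mx2 a b c d) =
  mx2 (C01_conj a) (C01_conj c) (C01_conj b) (C01_conj d).
Proof.
apply/matrixP => i j; rewrite !mxE.
by have [->|->] := ord2_cases i; have [->|->] := ord2_cases j.
Qed.

Lemma mx21 (S : pzRingType) : mx2 1 0 0 1 = 1 :> 'M[S]_2.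
Proof.
apply/matrixP => i j; rewrite !mxE.
by have [->|->] := ord2_cases i; have [->|->] := ord2_cases j.
Qed.

Lemma mx2Z (S : pzRingType) (k a b c d : S) :
  k *: mx2 a b c d = mx2 (k * a) (k * b) (k * c) (k * d).
Proof.
apply/matrixP => i j; rewrite !mxE.
by have [->|->] := ord2_cases i; have [->|->] := ord2_cases j.
Qed.

Lemma map_mx2 (S T : Type) (f : S -> T) (a b c d : S) :
  map_mx f (mx2 a b c d) = mx2 (f a) (f b) (f c) (f d).
Proof. by apply/matrixP => i j; rewrite !mxE !(fun_if f). Qed.

Definition flip : M2 := mx2 0 1 1 0.

Lemma flip_star : mxstar flip = flip.
Proof. by rewrite mxstar2 rmorph0 rmorph1. Qed.

Lemma flipK : 1 *: (flip * mxstar flip) = 1.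
Proof.
by rewrite scale1r flip_star mx2M !mul0r !mulr0 !mul1r add0r !addr0 mx21.
Qed.

Lemma flipK' : 1 *: (mxstar flip * flip) = 1.
Proof. by rewrite -[RHS]flipK flip_star. Qed.

Definition flip_endo : star_endo R :=
  conj_endo (rmorph1 (@C01_conj R)) flipK flipK'.

Lemma flip_endoE a : flip_endo a = mx2 (a 1 1) (a 1 0) (a 0 1) (a 0 0).
Proof.
rewrite /= /conj_by scale1r flip_star [a in LHS]mx2_eta !mx2M.
by rewrite !(mul0r, mul1r, mulr0, mulr1, add0r, addr0).
Qed.

Lemma flip_endo2 a b c d : flip_endo (mx2 a b c d) = mx2 d c b a.
Proof. by rewrite flip_endoE !mxE. Qed.

Lemma flip_endoK : involutive flip_endo.
Proof. by move=> a; rewrite !flip_endoE !mxE -mx2_eta. Qed.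

Definition unit_coord : C01 R :=
  c01 (fun t => continuous_comp (@val_unitI_cts R t) (@toCC_cts (val t))).
Local Notation w := unit_coord.

Lemma unit_coord_conj : C01_conj w = w.
Proof. by apply/c01P => t; exact: conjc_real. Qed.

Lemma denom_neq0 t : 1 + w t * w t != 0.
Proof.
have -> : 1 + w t * w t = toCC (1 + val t * val t).
  by rewrite /toCC rmorphD rmorphM rmorph1.
rewrite -(raddf0 toCC) (inj_eq (@complexI R)) gt_eqF //.
by rewrite ltr_pwDl // -expr2 sqr_ge0.
Qed.

Lemma denom_inv_cts : continuous (fun t => (1 + w t * w t)^-1).
Proof.
have c : continuous (fun t => 1 + w t * w t) := @c01_cts _ (1 + w * w).
by move=> t; exact: (@cvgV K _ _ _ (fun t => 1 + w t * w t) _ (denom_neq0 t) (c t)).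
Qed.

Definition denom_inv : C01 R := c01 denom_inv_cts.

Lemma denom_invE : denom_inv * (1 + w * w) = 1.
Proof. by apply/c01P => t; exact: mulVf (denom_neq0 t). Qed.

(** The conjugate is again an inverse of the real function 1 + t^2, and inverses are unique. *)
Lemma denom_inv_conj : C01_conj denom_inv = denom_inv.
Proof.
have := denom_invE; move/(congr1 (@C01_conj R)).
rewrite !(rmorphM, rmorphD, rmorph1) /= !unit_coord_conj => cE.
by rewrite -[LHS]mulr1 -denom_invE mulrCA cE mulr1.
Qed.

Definition rotation : M2 := mx2 1 (- w) w 1.

Lemma rot_star : mxstar rotation = mx2 1 w (- w) 1.
Proof. by rewrite mxstar2 rmorphN rmorph1 /= !unit_coord_conj. Qed.

Lemma rotK : denom_inv *: (rotation * mxstar rotation) = 1.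
Proof.
rewrite rot_star mx2M mx2Z !(mul1r, mulr1, mulrN, mulNr, opprK) subrr !mulr0.
by rewrite [w * w + 1]addrC denom_invE mx21.
Qed.

Lemma rotK' : denom_inv *: (mxstar rotation * rotation) = 1.
Proof.
rewrite rot_star mx2M mx2Z !(mul1r, mulr1, mulrN, mulNr, opprK) addNr !mulr0.
by rewrite [w * w + 1]addrC denom_invE mx21.
Qed.

Definition rot_endo : star_endo R := conj_endo denom_inv_conj rotK rotK'.

Lemma rot_endoE a : rot_endo a = denom_inv *: (rotation * a * mxstar rotation).
Proof. by []. Qed.

Definition id_endo : star_endo R :=
  @StarEndo R idfun (fun _ _ => erefl) (fun _ => erefl).

Definition at_endo (t : I01) : star_endo R := pull_endo (@cst_continuous I01 I01 t).

Lemma at_endoE t a : at_endo t a = cstm (evm t a).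
Proof. by apply/matrixP => i j; rewrite !mxE; apply/c01P. Qed.

End Rotation.

(** * The arrows and their action on V *)

Section Arrows.
Variable R : realType.
Local Notation K := (CC R).
Local Notation algA := (algA R).
Local Notation algB := (algB R).
Local Notation algC := (algC R).
Local Notation algD := (algD R).

Lemma csub_cstE (X : csubalg R) : csa_set X `<=` csa_set (csub_cst R) ->
  forall a : X, val a = cstm (evm (I0 R) (val a)).
Proof. by move=> XD a; exact: (XD _ (set_mem (valP a))). Qed.

Lemma flip_algB a : csa_set algB a -> csa_set algB (flip_endo R a).
Proof.
move=> [/cst_setP ac /diag0P aD]; split.
  apply/cst_setP => i j t; rewrite flip_endoE !mxE.
  by do 2![case: ifP => _].
apply/diag0P => i j ij; rewrite flip_endoE mxE.
by have [iE|iE] := ord2_cases i; have [jE|jE] := ord2_cases j;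
  move: ij; rewrite iE jE //= => _; apply: aD.
Qed.

Lemma flip_algD a : csa_set algD a -> csa_set algD (flip_endo R a).
Proof.
move=> /cst_setP ac; apply/cst_setP => i j t; rewrite flip_endoE !mxE.
by do 2![case: ifP => _].
Qed.

(** The rotation is the identity at t = 0. Hence [arr_g] has values in C and is undone by evaluation
    at 0, just like the inclusion. *)
Lemma evm_rot_endo0 a : evm (I0 R) (rot_endo R a) = evm (I0 R) a.
Proof.
have w0 : unit_coord R (I0 R) = 0 by [].
have rot0 : evm (I0 R) (rotation R) = 1.
  rewrite -mx21; apply/matrixP => i j; rewrite !mxE /ev.
  by do 2![case: ifP => _] => //; exact: oppr0.
have rotS0 : evm (I0 R) (mxstar (rotation R)) = 1.
  by rewrite evmS rot0 trmx1 map_mx1.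
rewrite rot_endoE evmZ !evmM rot0 rotS0 mul1r mulr1.
rewrite -[X in X *: _]/((1 + unit_coord R (I0 R) * unit_coord R (I0 R))^-1).
by rewrite w0 mulr0 addr0 invr1 scale1r.
Qed.

Lemma rot_algB a : csa_set algB a -> csa_set algC (rot_endo R a).
Proof. by move=> [_ aD] m Tm; rewrite evm_rot_endo0; exact: aD. Qed.

Lemma at_algB a : csa_set algC a -> csa_set algB (at_endo (I0 R) a).
Proof.
move=> aC; split; first by rewrite at_endoE; exact: cstm_cst.
by move=> m Tm; rewrite at_endoE evm_cst; exact: aC.
Qed.

Lemma at_algD a : csa_set algC a -> csa_set algD (at_endo (I1 R) a).
Proof. by move=> _; rewrite at_endoE; exact: cstm_cst. Qed.

Definition arr_e : star_hom algA algB := @restr_hom _ _ _ (id_endo R) (@algAB R).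
Definition arr_s : star_hom algB algB := restr_hom flip_algB.
Definition arr_f : star_hom algB algC := @restr_hom _ _ _ (id_endo R) (@algBC R).
Definition arr_g : star_hom algB algC := restr_hom rot_algB.
Definition arr_h : star_hom algC algD := restr_hom at_algD.
Definition arr_v : star_hom algD algD := restr_hom flip_algD.
(** Evaluation at 0 is a left inverse of both [arr_f] and [arr_g], and up to homotopy a right
    inverse of [arr_f]. *)
Definition retr : star_hom algC algB := restr_hom at_algB.

(** Any two unital linear maps agree on scalars; this yields both identities that involve
    [arr_e]. *)
Lemma algA_scalar (a : algA) : exists z, val a = C01_cst z *: 1.
Proof.
have [aD /scal0P aS] := set_mem (valP a); exists (val a 0 0 (I0 R)).
rewrite [LHS]aD aS; apply/matrixP => i j; rewrite !mxE mulr_natr.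
exact: rmorphMn.
Qed.

Lemma arr_fe : arr_f \o arr_e =1 arr_g \o arr_e.
Proof.
move=> a; apply: val_inj => /=; have [z ->] := algA_scalar a.
by rewrite [RHS](endoZ (rot_endo R)) rmorph1.
Qed.

Lemma arr_se : arr_s \o arr_e =1 arr_e.
Proof.
move=> a; apply: val_inj => /=; have [z ->] := algA_scalar a.
by rewrite [LHS](endoZ (flip_endo R)) rmorph1.
Qed.

(** The flip is conjugation by a constant matrix, hence commutes with evaluation. *)
Lemma at_flip t (a : 'M[C01 R]_2) :
  at_endo t (flip_endo R a) = flip_endo R (at_endo t a).
Proof.
rewrite !flip_endoE; apply/matrixP => i j; rewrite !mxE.
by do 2![case: ifP => _].
Qed.

Lemma arr_hfs : arr_h \o arr_f \o arr_s =1 arr_v \o arr_h \o arr_f.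
Proof. by move=> a; apply: val_inj; exact: at_flip. Qed.

(** At t = 1 the rotated matrix has both diagonal entries (x + y) / 2 and both other entries (x - y)
    / 2, so the flip fixes it. *)
Lemma flip_rot1 (x y : C01 R) :
  evm (I1 R) (flip_endo R (rot_endo R (mx2 x 0 0 y))) =
  evm (I1 R) (rot_endo R (mx2 x 0 0 y)).
Proof.
have w1 : (ev (I1 R) : {rmorphism C01 R -> K}) (unit_coord R) = 1 by [].
rewrite rot_endoE rot_star /rotation !mx2M mx2Z flip_endo2 /evm !map_mx2.
rewrite !(rmorphM, rmorphD, rmorphN, rmorph1, rmorph0) w1.
by rewrite !(mul0r, mulr0, mul1r, mulr1, add0r, addr0, mulN1r, mulrN1, opprK).
Qed.

Lemma algB_diag (a : algB) : val a = mx2 (val a 0 0) 0 0 (val a 1 1).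
Proof.
have /diag0P aD := algBC (set_mem (valP a)).
have [/cst_setP ac _] := set_mem (valP a).
have a01 : val a 0 1 = 0 by apply/c01P => t; rewrite ac aD.
have a10 : val a 1 0 = 0 by apply/c01P => t; rewrite ac aD.
by rewrite [LHS]mx2_eta a01 a10.
Qed.

Lemma arr_vhg : arr_v \o arr_h \o arr_g =1 arr_h \o arr_g.
Proof.
move=> a; apply: val_inj.
have -> : val ((arr_v \o arr_h \o arr_g) a) =
    at_endo (I1 R) (flip_endo R (rot_endo R (val a))) by symmetry; exact: at_flip.
have -> : val ((arr_h \o arr_g) a) = at_endo (I1 R) (rot_endo R (val a)) by [].
by rewrite !at_endoE algB_diag flip_rot1.
Qed.

Lemma retr_f : retr \o arr_f =1 id.
Proof.
move=> b; apply: val_inj; rewrite -[LHS]/(at_endo (I0 R) (val b)) at_endoE.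
by rewrite -csub_cstE // => a [].
Qed.

Lemma retr_g : retr \o arr_g =1 id.
Proof.
move=> b; apply: val_inj.
rewrite -[LHS]/(at_endo (I0 R) (rot_endo R (val b))) at_endoE evm_rot_endo0.
by rewrite -csub_cstE // => a [].
Qed.

Lemma f_retr : arr_f \o retr =1 scaleC (I0 R).
Proof.
move=> c; apply: val_inj; apply/matrixP => i j.
rewrite /= !mxE; apply/c01P => t.
rewrite -[LHS]/(val c i j (I0 R)) -[RHS]/(val c i j (scaleI (I0 R) t)).
by congr (fun_of_C01 _ _); apply: val_inj; rewrite /= mul0r.
Qed.

Lemma Vretr_f : Vmap retr \o Vmap arr_f =1 id.
Proof.
move=> u; rewrite -(@Vmap_comp _ _ _ arr_f retr idfun) ?Vmap_id //.
by move=> b; rewrite retr_f.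
Qed.

Lemma Vretr_g : Vmap retr \o Vmap arr_g =1 id.
Proof.
move=> u; rewrite -(@Vmap_comp _ _ _ arr_g retr idfun) ?Vmap_id //.
by move=> b; rewrite retr_g.
Qed.

(** The composite is the dilation by r = 0, which [scale_equiv] joins to the identity. *)
Lemma Vf_retr : Vmap arr_f \o Vmap retr =1 id.
Proof.
move=> u; rewrite -(@Vmap_comp _ _ _ retr arr_f (scaleC (I0 R))); last first.
  by move=> c; rewrite f_retr.
have [a ->] := Vcls_surj u; rewrite VmapE; apply/VclsP/mvn_sym.
exact/scale_equiv/imxK.
Qed.

(** The isomorphism is transported from B along evaluation at 0, so its compatibility with [arr_f]
    and [arr_g] reduces to [Vretr_f] and [Vretr_g]. *)
Definition etaC : V algC -> nat * nat := @etaB R \o Vmap retr.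
HB.instance Definition _ := GRing.Additive.on etaC.

Lemma etaC_iso : ou_iso (V1 algC) (1%N, 1%N) etaC.
Proof.
have [bijB oneB] := etaB_iso R; split; last first.
  exact: (etrans (congr1 (@etaB R) (Vmap_V1 retr)) oneB).
by apply: bij_comp bijB _; exists (Vmap arr_f); [exact: Vf_retr|exact: Vretr_f].
Qed.

Lemma etaB_e : @etaB R \o Vmap arr_e =1 arrow_e \o @etaA R.
Proof.
have rk i : rkV (repB R i) \o Vmap arr_e =1 rkV (repA R tt).
  apply: rkV_Vmap => n x; congr (\tr _); apply/matrixP => k l; rewrite !mxE.
  have [_ /scal0P/matrixP/(_ i i)] := set_mem (valP (x k l)).
  by rewrite !mxE eqxx.
by move=> u; exact: (congr2 pair (rk 0 u) (rk 1 u)).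
Qed.

Lemma ent_flip (X : csubalg R) t i j (a b : X) : i != j ->
  val b = flip_endo R (val a) -> ent t i i b = ent t j j a.
Proof.
move=> ij ba; rewrite /ent ba flip_endoE mxE.
by have [iE|iE] := ord2_cases i; have [jE|jE] := ord2_cases j;
  move: ij; rewrite iE jE.
Qed.

Lemma etaB_s : @etaB R \o Vmap arr_s =1 arrow_s \o @etaB R.
Proof.
have rk i j : i != j -> rkV (repB R i) \o Vmap arr_s =1 rkV (repB R j).
  move=> ij; apply: rkV_Vmap => n x; congr (\tr _); apply/matrixP => k l.
  by rewrite !mxE; exact: ent_flip.
by move=> u; exact: (congr2 pair (rk 0 1 isT u) (rk 1 0 isT u)).
Qed.

Lemma etaC_f : etaC \o Vmap arr_f =1 @etaB R.
Proof. by move=> u; congr etaB; exact: Vretr_f. Qed.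

Lemma etaC_g : etaC \o Vmap arr_g =1 @etaB R.
Proof. by move=> u; congr etaB; exact: Vretr_g. Qed.

(** Elements of B are constant, so evaluation at 1 keeps their diagonal entries, and the trace over
    D is the sum of the traces of the two characters of B. *)
Lemma etaD_hf : @etaD R \o Vmap arr_h \o Vmap arr_f =1 arrow_h \o @etaB R.
Proof.
pose hf : {rmorphism algB -> algD} := arr_h \o arr_f.
have rk : forall u, rkV (repD R tt) (Vmap hf u) =
    addn (rkV (repB R 0) u) (rkV (repB R 1) u).
  apply: rkV_VmapD => n x; rewrite mxtrace_block.
  have xE i : entmx (I0 R) i i (map_mx hf x) = entmx (I0 R) i i x.
    apply/matrixP => k l; have [/cst_setP xc _] := set_mem (valP (x k l)).
    rewrite !mxE /ent (_ : val (hf _) = at_endo (I1 R) (val (x k l))) //.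
    by rewrite at_endoE !mxE; exact: xc.
  exact: (congr2 (fun x y => \tr x + \tr y) (xE 0) (xE 1)).
move=> u; rewrite -[RHS]rk; congr etaD.
by rewrite [RHS](@Vmap_comp _ _ _ arr_f arr_h hf).
Qed.

(** By [Vf_retr] every class of V(C) comes from B, where [etaD_hf] applies. *)
Lemma etaD_h : @etaD R \o Vmap arr_h =1 arrow_h \o etaC.
Proof. by move=> u; rewrite -{1}[u]Vf_retr; exact: etaD_hf. Qed.

(** The flip exchanges the two diagonal blocks, which leaves the trace unchanged. *)
Lemma etaD_v : @etaD R \o Vmap arr_v =1 @etaD R.
Proof.
apply: rkV_Vmap => n x; rewrite !mxtrace_block addrC.
have xE i j : i != j -> entmx (I0 R) i i (map_mx arr_v x) = entmx (I0 R) j j x.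
  by move=> ij; apply/matrixP => k l; rewrite !mxE; exact: ent_flip.
exact: (congr2 (fun x y => \tr x + \tr y) (xE 1 0 isT) (xE 0 1 isT)).
Qed.

Lemma arr_sK : involutive arr_s.
Proof. by move=> b; apply: val_inj; exact: flip_endoK. Qed.

Lemma arr_vK : involutive arr_v.
Proof. by move=> b; apply: val_inj; exact: flip_endoK. Qed.

End Arrows.

Theorem theorem12p5 (R : realType) :
  exists (A B C D : csubalg R)
    (e : star_hom A B) (s : star_hom B B) (f g : star_hom B C)
    (h : star_hom C D) (v : star_hom D D),
  [/\ f \o e =1 g \o e, s \o e =1 e,
      h \o f \o s =1 v \o h \o f & v \o h \o g =1 h \o g] /\
  [/\ bijective s, involutive s, bijective v & involutive v] /\
  exists (etaA : {additive V A -> nat}) (etaB : {additive V B -> (nat * nat)%type})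
    (etaC : {additive V C -> (nat * nat)%type}) (etaD : {additive V D -> nat}),
  [/\ ou_iso (V1 A) 1%N etaA, ou_iso (V1 B) (1%N, 1%N) etaB,
      ou_iso (V1 C) (1%N, 1%N) etaC & ou_iso (V1 D) 2%N etaD] /\
  [/\ etaB \o Vmap e =1 arrow_e \o etaA,
      etaB \o Vmap s =1 arrow_s \o etaB,
      etaC \o Vmap f =1 etaB /\ etaC \o Vmap g =1 etaB,
      etaD \o Vmap h =1 arrow_h \o etaC &
      etaD \o Vmap v =1 etaD].
Proof.
exists (algA R), (algB R), (algC R), (algD R).
exists (arr_e R), (arr_s R), (arr_f R), (arr_g R), (arr_h R), (arr_v R).
split; first by split;
  [exact: arr_fe|exact: arr_se|exact: arr_hfs|exact: arr_vhg].
split.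
  by split; [exact: inv_bij (@arr_sK R)|exact: arr_sK|
             exact: inv_bij (@arr_vK R)|exact: arr_vK].
exists (@etaA R : {additive _ -> _}), (@etaB R : {additive _ -> _}).
exists (@etaC R : {additive _ -> _}), (@etaD R : {additive _ -> _}).
split; first by split;
  [exact: etaA_iso|exact: etaB_iso|exact: etaC_iso|exact: etaD_iso].
split; [exact: etaB_e|exact: etaB_s| |exact: etaD_h|exact: etaD_v].
by split; [exact: etaC_f|exact: etaC_g].
Qed.
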